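(* Let $M$ be a maximal subgroup of Thompson's group $F$ which has infinite index in $F$. Then $M$ is a closed subgroup of $F$.
   Context: Thompson's group $F$ is the group of all increasing piecewise-linear homeomorphisms of $[0,1]$ with finitely many breakpoints, all in $\mathbb{Z}[\frac12]\cap(0,1)$, and all slopes integer powers of $2$; composition is from left to right. Tree-diagrams. In a full finite binary tree (every vertex is a leaf or has exactly one left and one right child; a single vertex is allowed) label left edges $0$ and right edges $1$; a branch is a maximal simple path from the root, identified with its label, a finite binary word. For a finite binary word $u$, $[u]$ is the dyadic interval $[.u,\,.u1^{\mathbb N}]\subseteq[0,1]$. A tree-diagram is a pair $(T_+,T_-)$ of full finite binary trees with the same number $n$ of leaves; if their branches, ordered left to right, are $u_1,\dots,u_n$ and $v_1,\dots,v_n$, then it has the pairs of branches $u_i\to v_i$ and represents the element of $F$ mapping each $[u_i]$ linearly onto $[v_i]$. It is reduced if for no $i$ do the leaves number $i$ and $i+1$ have a common father both in $T_+$ and in $T_-$; every element of $F$ is represented by a unique reduced tree-diagram. Tree-automata. A rooted tree-automaton $\mathcal A_r$ is a directed edge-labeled graph with a distinguished root vertex $r$ such that: (1) every vertex has either zero or two outgoing edges; (2) if a vertex has two outgoing edges (it is then called a father), one is labeled $0$ and the other $1$, and their end vertices are its left and right child respectively; (3) if $x_1\ne x_2$ are fathers, then their left children are distinct or their right children are distinct; (4) every vertex is the end of a directed path starting at $r$. A finite binary word $u$ is readable on $\mathcal A_r$ if there is a (necessarily unique) directed path from $r$ labeled $u$; its end vertex is denoted $u^+$. A tree-diagram $(T_+,T_-)$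 is accepted by $\mathcal A_r$ if all branches of $T_+$ and $T_-$ are readable on $\mathcal A_r$ and $u^+=v^+$ for each of its pairs of branches $u\to v$. $\mathcal{DG}(\mathcal A_r)$ is the subgroup of $F$ of all elements whose reduced tree-diagrams are accepted by $\mathcal A_r$. A subgroup $H\le F$ is closed if $H=\mathcal{DG}(\mathcal A_r)$ for some rooted tree-automaton $\mathcal A_r$. (It is known that this is equivalent to: every $f\in F$ which is piecewise-$H$, i.e. for which there is a finite subdivision of $[0,1]$ such that on each interval of the subdivision $f$ coincides with some element of $H$, belongs to $H$.) *)

(* Defs.v *)
From HB Require Import structures.
From mathcomp Require Import all_boot all_order all_algebra.
From mathcomp Require Import all_classical all_reals all_analysis.
From mathcomp Require Import lra ring.

Set Implicit Arguments.
Unset Strict Implicit.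
Unset Printing Implicit Defensive.

Import Order.TTheory GRing.Theory Num.Theory.
Import numFieldNormedType.Exports.

Local Open Scope classical_set_scope.
Local Open Scope ring_scope.

Section Subgroups.
Variable G : groupType.
Implicit Types H K : set G.

Definition subgroup H : Prop := group_closed (mem H).

Definition maximal_subgroup H : Prop :=
  [/\ subgroup H, H <> setT &
      forall K, subgroup K -> H `<=` K -> K = H \/ K = setT].

Definition right_coset H (g : G) : set G := [set (h * g)%g | h in H].

Definition infinite_index H : Prop := infinite_set (range (right_coset H)).

End Subgroups.

Section ThompsonGroup.
Variable R : realType.
Implicit Types (f g : R -> R) (x y a b : R) (s : seq R).

Definition dyadic x : Prop := exists (m : int) (n : nat), x = m%:~R / 2 ^+ n.

(* The points of s are the possible breakpoints of f: any closed subinterval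
   of [0, 1] without a point of s in its interior is contained in one linear
   piece of f. *)
Definition dyadic_pl f : Prop :=
  exists2 s : seq R, {in s, forall x, 0 < x < 1 /\ dyadic x} &
    forall a b, 0 <= a -> a < b -> b <= 1 ->
      {in s, forall x, x \notin `]a, b[} ->
      exists (k : int) (c : R), {in `[a, b], forall x, f x = 2 ^ k * x + c}.

(* A homeomorphism of [0, 1] fixing 0 and 1 is encoded as its extension by the
   identity, a homeomorphism of R; in this way equality of elements is equality
   of functions. *)
Definition thompson_map f : Prop :=
  [/\ forall x, x \notin `[0, 1] -> f x = x,
      {homo f : x y / x < y},
      continuous f,
      exists g, [/\ cancel f g, cancel g f & continuous g] &
      dyadic_pl f].

Record thompsonF := ThompsonF {
  tmap :> R -> R;
  tmapP : `[< thompson_map tmap >] }.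

HB.instance Definition _ := [isSub for tmap].
HB.instance Definition _ := [Choice of thompsonF by <:].

Lemma thompsonF_ext (f g : thompsonF) : (f =1 g) -> f = g.
Proof. by move=> fg; apply/val_inj/funext. Qed.

Lemma thompson_fix f x : thompson_map f -> ~~ (0 < x < 1) -> f x = x.
Proof.
move=> [fid fm fc [g [fK gK gc]] _] hx.
have fle : {mono f : u v / u <= v} by exact: le_mono.
have [h|h] := boolP (x \in `[0, 1]); last exact: fid.
have h1 y : y < 0 -> f y = y by move=> ?; apply: fid; rewrite in_itv /=; lra.
have h2 y : 1 < y -> f y = y by move=> ?; apply: fid; rewrite in_itv /=; lra.
have h3 y : y < 0 -> g y = y by move=> h0; rewrite -{1}(h1 _ h0) fK.
have h4 y : 1 < y -> g y = y by move=> h0; rewrite -{1}(h2 _ h0) fK.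
move: h hx; rewrite in_itv /= => /andP[x0 x1] hx.
have /orP[/eqP->|/eqP->] : (x == 0) || (x == 1) by lra.
- case: (ltgtP (f 0) 0) => // h.
    by have := h3 _ h; rewrite fK; lra.
  have : f (- 1) < f 0 by apply: fm; lra.
  have k0 : g 0 < 0 by rewrite -(leW_mono fle) gK.
  by have := h1 _ k0; rewrite gK; lra.
- case: (ltgtP (f 1) 1) => // h.
    have k0 : 1 < g 1 by rewrite -(leW_mono fle) gK.
    by have := h2 _ k0; rewrite gK; lra.
  by have := h4 _ h; rewrite fK; lra.
Qed.

Lemma dyadic0 : dyadic 0.
Proof. by exists 0, 0%N; rewrite mul0r. Qed.

Lemma dyadic1 : dyadic 1.
Proof. by exists 1, 0%N; rewrite expr0 divr1. Qed.

Lemma dyadicD x y : dyadic x -> dyadic y -> dyadic (x + y).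
Proof.
move=> [m [n ->]] [p [q ->]]; exists (m * 2 ^+ q + p * 2 ^+ n), (n + q)%N.
have h k : (2 : R) ^+ k != 0 by rewrite expf_neq0 // pnatr_eq0.
rewrite rmorphD !rmorphM /= !rmorphXn /= exprD; field.
by rewrite !h.
Qed.

Lemma dyadicN x : dyadic x -> dyadic (- x).
Proof. by move=> [m [n ->]]; exists (- m), n; rewrite rmorphN mulNr. Qed.

Lemma dyadicZ (k : int) x : dyadic x -> dyadic (2 ^ k * x).
Proof.
move=> [m [n ->]]; have h i : (2 : R) ^+ i != 0 by rewrite expf_neq0 // pnatr_eq0.
case: k => k.
  by exists (2 ^+ k * m), n; rewrite rmorphM /= rmorphXn /= mulrA.
by exists m, (k.+1 + n)%N; rewrite NegzE -exprnN exprD; field; rewrite !h.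
Qed.

Lemma pow2_gt0 (k : int) : 0 < (2 : R) ^ k.
Proof. by rewrite exprz_gt0. Qed.

Lemma thompson_dyadic_iff f x : thompson_map f ->
  dyadic x <-> dyadic (f x).
Proof.
move=> ft; have [fid fm fc finv [s sP fs]] := ft.
have [xin|xout] := boolP (0 < x < 1); last by rewrite thompson_fix.
suff H n y : (count (fun z => (z < y)%R) s < n)%N -> 0 < y < 1 ->
    dyadic y <-> dyadic (f y) by exact: (H _ _ (ltnSn _)).
elim: n y => // n IH y cy /andP[y0 y1].
suff [p [p0 py pd fpd ps]] : exists p, [/\ 0 <= p, p < y, dyadic p, dyadic (f p) &
    {in s, forall z, z \notin `]p, y[}].
  have [k [c H]] := fs p y p0 py (ltW y1) ps.
  have Ep : f p = 2 ^ k * p + c by apply: H; rewrite in_itv /= lexx ltW.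
  have Ey : f y = 2 ^ k * y + c by apply: H; rewrite in_itv /= lexx ltW.
  split=> d.
    have -> : f y = f p + 2 ^ k * (y - p) by rewrite Ey Ep; ring.
    by apply: dyadicD => //; apply/dyadicZ/dyadicD => //; apply: dyadicN.
  have -> : y = p + 2 ^ (- k) * (f y - f p).
    have h : (2 : R) ^ k != 0 by rewrite gt_eqF ?pow2_gt0.
    by rewrite Ey Ep -invr_expz; field.
  by apply: dyadicD => //; apply/dyadicZ/dyadicD => //; apply: dyadicN.
pose t := [seq z <- s | z < y].
pose p := \big[Num.max/0]_(z <- t) z.
have tp : {in t, forall z, z <= p} by move=> z zt; exact: le_bigmax_seq.
have pt : p = 0 \/ p \in t.
  rewrite /p; elim: t {tp p} => [|z t IHt]; first by left; rewrite big_nil.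
  rewrite big_cons; case: leP => _; last by right; rewrite mem_head.
  by case: IHt => [->|h]; [left|right; rewrite inE h orbT].
clearbody p; exists p.
have ps : {in s, forall z, z \notin `]p, y[}.
  move=> z zs; rewrite in_itv /= negb_and -!leNgt.
  by case: (ltP z y) => zy; rewrite ?orbT ?orbF // tp // mem_filter zy zs.
case: pt => [p0|].
  rewrite {}p0 in ps *; split=> //; first exact: dyadic0.
  by rewrite thompson_fix ?ltxx //; exact: dyadic0.
rewrite mem_filter => /andP[py pins]; have [/andP[p0 p1] pd] := sP _ pins.
split => //; first exact: ltW.
apply/(IH p) => //; last by rewrite p0.
rewrite -ltnS; apply: leq_trans cy; rewrite ltnS.
rewrite (@eq_in_count _ _ (predI (fun z => z < p) (fun z => z < y))); last first.
  by move=> z _ /=; case: ltP => //= zp; rewrite (lt_trans zp py).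
rewrite -count_filter -/t.
rewrite -(size_filter (fun z => z < y)) -/t -(count_predC (fun z => z < p) t) -[ltnLHS]addn0 ltn_add2l.
by rewrite -has_count; apply/hasP; exists p; rewrite ?mem_filter ?py //= ltxx.
Qed.

Lemma thompson_mono f : thompson_map f -> {mono f : x y / x < y}.
Proof. by move=> [_ fm _ _ _]; apply/leW_mono/le_mono. Qed.

Lemma thompson_inside f x : thompson_map f -> (0 < f x < 1) = (0 < x < 1).
Proof.
move=> ft; rewrite -{1}(thompson_fix (x := 0) ft) ?ltxx //.
by rewrite -{1}(thompson_fix (x := 1) ft) ?ltxx ?andbF // !thompson_mono.
Qed.

Lemma thompson_map_id : thompson_map id.
Proof.
have idc : continuous (@id R) by move=> x; exact: cvg_id.
split=> //; first by exists id.
exists [::] => // a b _ _ _ _; exists 0, 0 => x _.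
by rewrite expr0z mul1r addr0.
Qed.

Lemma thompson_map_comp f g :
  thompson_map f -> thompson_map g -> thompson_map (g \o f).
Proof.
move=> ft gt; have [fid fm fc [f' [fK f'K f'c]] [s sP fs]] := ft.
have [gid gm gc [g' [gK g'K g'c]] [t tP gs]] := gt.
split.
- by move=> x hx /=; rewrite fid // gid.
- by move=> x y xy /=; apply/gm/fm.
- by move=> x; apply: continuous_comp; [exact: fc|exact: gc].
- exists (f' \o g'); split; [exact: can_comp|exact: can_comp|].
  by move=> x; apply: continuous_comp; [exact: g'c|exact: f'c].
- exists (s ++ map f' t).
    move=> x; rewrite mem_cat => /orP[/sP//|/mapP[y /tP[y01 yd] ->]].
    rewrite -(thompson_inside _ ft) f'K; split => //.
    by apply/(thompson_dyadic_iff _ ft); rewrite f'K.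
  move=> a b a0 ab b1 H.
  have [|k [c fE]] := fs a b a0 ab b1.
    by move=> x xs; apply: H; rewrite mem_cat xs.
  have f0 : f 0 = 0 by rewrite thompson_fix ?ltxx.
  have f1 : f 1 = 1 by rewrite thompson_fix ?ltxx ?andbF.
  have fle := le_mono fm.
  have [||||l [d gE]] := gs (f a) (f b).
  + by rewrite -f0 fle.
  + exact: fm.
  + by rewrite -f1 fle.
  + move=> x xt; apply: contra (H (f' x) _).
      by rewrite !in_itv /= -{1 2}(f'K x) !thompson_mono.
    by rewrite mem_cat map_f ?orbT.
  exists (l + k), (2 ^ l * c + d) => x xab /=.
  rewrite gE; last by rewrite in_itv /= !fle; rewrite in_itv in xab.
  by rewrite fE // expfzDr ?pnatr_eq0 //; ring.
Qed.

Lemma thompson_map_inv f g : thompson_map f -> cancel f g -> cancel g f ->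
  thompson_map g.
Proof.
move=> ft fK gK; have [fid fm fc [f' [f'K _ f'c]] [s sP fs]] := ft.
have Eg : g = f' by apply/funext => x; rewrite -{2}(gK x) f'K.
have f0 : f 0 = 0 by rewrite thompson_fix ?ltxx.
have f1 : f 1 = 1 by rewrite thompson_fix ?ltxx ?andbF.
have fle := le_mono fm.
split.
- by move=> x hx; rewrite -{1}(fid x hx) fK.
- by move=> x y xy; rewrite -(thompson_mono ft) !gK.
- by rewrite Eg.
- by exists f; split.
- exists (map f s).
    move=> _ /mapP[y /sP[y01 yd] ->]; rewrite thompson_inside //; split => //.
    exact: (thompson_dyadic_iff y ft).1.
  move=> a b a0 ab b1 H.
  have [||||k [c fE]] := fs (g a) (g b).
  + by rewrite -fle f0 gK.
  + by rewrite -(thompson_mono ft) !gK.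
  + by rewrite -fle f1 gK.
  + move=> x xs; apply: contra (H (f x) (map_f _ xs)).
    by rewrite !in_itv /= -{2}(gK a) -{2}(gK b) !thompson_mono.
  exists (- k), (- (2 ^ (- k) * c)) => x xab.
  have h : (2 : R) ^ k != 0 by rewrite gt_eqF ?pow2_gt0.
  have /fE : g x \in `[g a, g b].
    by rewrite in_itv /= -(fle (g a)) -(fle _ (g b)) !gK; rewrite in_itv in xab.
  by rewrite gK => E; rewrite {2}E -invr_expz; field.
Qed.

Definition tone : thompsonF := ThompsonF (asboolT thompson_map_id).

Lemma tmul_subproof (f g : thompsonF) : `[< thompson_map (g \o f) >].
Proof. by apply/asboolP/thompson_map_comp; apply/asboolP/tmapP. Qed.

(* Composition is from left to right. *)
Definition tmul (f g : thompsonF) : thompsonF := ThompsonF (tmul_subproof f g).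

Definition inv_fun f y : R := xget y [set x | f x = y].

Lemma inv_funK f : thompson_map f -> cancel f (inv_fun f) /\ cancel (inv_fun f) f.
Proof.
move=> [_ _ _ [g [fK gK _]] _].
have H : cancel (inv_fun f) f.
  by move=> y; rewrite /inv_fun; case: xgetP => [x _ //|/(_ (g y))]; rewrite /= gK.
by split=> // x; apply: (can_inj fK); rewrite H.
Qed.

Lemma tinv_subproof (f : thompsonF) : `[< thompson_map (inv_fun f) >].
Proof.
have /asboolP ft := tmapP f; have [? ?] := inv_funK ft.
exact/asboolP/(thompson_map_inv ft).
Qed.

Definition tinv (f : thompsonF) : thompsonF := ThompsonF (tinv_subproof f).

Lemma tmulA : associative tmul.
Proof. by move=> f g h; apply: thompsonF_ext. Qed.

Lemma tmul1f : left_id tone tmul.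
Proof. by move=> f; apply: thompsonF_ext. Qed.

Lemma tmulf1 : right_id tone tmul.
Proof. by move=> f; apply: thompsonF_ext. Qed.

Lemma tmulVf : left_inverse tone tinv tmul.
Proof.
move=> f; apply: thompsonF_ext => x /=.
by have /asboolP ft := tmapP f; have [_ ->] := inv_funK ft.
Qed.

Lemma tmulfV : right_inverse tone tinv tmul.
Proof.
move=> f; apply: thompsonF_ext => x /=.
by have /asboolP ft := tmapP f; have [-> _] := inv_funK ft.
Qed.

HB.instance Definition _ :=
  isGroup.Build thompsonF tmulA tmul1f tmulf1 tmulVf tmulfV.

End ThompsonGroup.

(* false is the label 0 (left) and true the label 1 (right). *)
Definition word := seq bool.

Inductive bintree := Leaf | Node of bintree & bintree.

(* The branches of a full binary tree, from left to right. *)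
Fixpoint branches (T : bintree) : seq word :=
  if T is Node l r then
    map (cons false) (branches l) ++ map (cons true) (branches r)
  else [:: [::]].

Record tree_diagram := TreeDiagram {
  tplus : bintree;
  tminus : bintree;
  same_leaves : size (branches tplus) = size (branches tminus) }.

Definition branch_pairs (D : tree_diagram) : seq (word * word) :=
  zip (branches (tplus D)) (branches (tminus D)).

(* The vertices of a tree are identified with the words read from the root. *)
Definition common_father (u v : word) : Prop :=
  exists p, u = rcons p false /\ v = rcons p true.

Definition reduced (D : tree_diagram) : Prop :=
  ~ exists i, [/\ (i.+1 < size (branch_pairs D))%N,
    common_father (nth [::] (branches (tplus D)) i)
                  (nth [::] (branches (tplus D)) i.+1) &
    common_father (nth [::] (branches (tminus D)) i)
                  (nth [::] (branches (tminus D)) i.+1)].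

Section Represents.
Variable R : realType.

(* The binary fraction .u is the left endpoint of [u]; the right endpoint
   .u111... is .u + 2^-|u|. *)
Definition lower (u : word) : R :=
  \sum_(i < size u) (nth false u i)%:R / 2 ^+ i.+1.

Definition upper (u : word) : R := lower u + 2 ^- size u.

Definition maps_linearly (f : R -> R) (u v : word) : Prop :=
  {in `[lower u, upper u], forall x,
     f x = lower v + (upper v - lower v) / (upper u - lower u) * (x - lower u)}.

Definition represents (D : tree_diagram) (f : thompsonF R) : Prop :=
  {in branch_pairs D, forall uv, maps_linearly f uv.1 uv.2}.

End Represents.

Section Read.
Variables (V : Type) (children : V -> option (V * V)).

Fixpoint read_from (x : V) (u : word) : option V :=
  if u is b :: u' then
    if children x is Some (l, r) then read_from (if b then r else l) u'
    else None
  else Some x.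

End Read.

(* [start] is the root r. [children x] is [None] if x has no outgoing edge, and [Some (l, r)] if the
   outgoing edges of x are an edge labeled 0 to l and an edge labeled 1 to r. *)
Record tree_automaton := TreeAutomaton {
  vertex : Type;
  start : vertex;
  children : vertex -> option (vertex * vertex);
  fathers_distinct : forall x1 x2 l1 r1 l2 r2, x1 <> x2 ->
    children x1 = Some (l1, r1) -> children x2 = Some (l2, r2) ->
    l1 <> l2 \/ r1 <> r2;
  reachable : forall x, exists u, read_from children start u = Some x }.

(* [end_vertex A u] is [Some] of the end vertex u^+ if u is readable on A, and
   [None] otherwise. *)
Definition end_vertex (A : tree_automaton) (u : word) : option (vertex A) :=
  read_from (@children A) (start A) u.

Definition readable (A : tree_automaton) (u : word) : Prop :=
  exists x, end_vertex A u = Some x.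

Definition accepted (A : tree_automaton) (D : tree_diagram) : Prop :=
  [/\ {in branches (tplus D), forall u, readable A u},
      {in branches (tminus D), forall v, readable A v} &
      {in branch_pairs D, forall uv, end_vertex A uv.1 = end_vertex A uv.2}].

(* The reduced tree-diagram of f exists and is unique. *)
Definition DG (R : realType) (A : tree_automaton) : set (thompsonF R) :=
  [set f | exists D, [/\ reduced D, represents D f & accepted A D]].

Definition closed_subgroup (R : realType) (H : set (thompsonF R)) : Prop :=
  exists A : tree_automaton, H = DG A.

(* Main.v *)
Require Import Defs.
From HB Require Import structures.
From mathcomp Require Import all_boot all_order all_algebra.
From mathcomp Require Import all_classical all_reals all_analysis.
From mathcomp Require Import lra ring zify.

(** Let M be a maximal subgroup of infinite index. The elements of F that
    coincide with elements of M on the pieces of a finite subdivision of [0,1]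
    form a subgroup [piecewise M] containing M, so by maximality it is M or F.

    If it is M, then M is closed under gluing two of its elements at a dyadic
    point where they agree. Call words u, v linked when some element of M maps
    [u] linearly onto [v]; the classes of linked words are the vertices of a
    tree-automaton, whose condition on fathers is exactly closure under gluing
    at the midpoint of [u] ([linked_node]). An element of M is accepted because
    its own branches are linked by itself, and an accepted element is obtained
    by gluing elements of M along its tree ([glued_closed]).

    If it is F, there is a contradiction. A normal maximal subgroup has finite
    index ([normal_maximal_finite_index]), so M is not normal, and it suffices
    to derive that it is. Now every f in F has, on either side of any point, the
    germ of some element of M; the difficulty is to have both sides at once.

    - Fix a dyadic x0 and let S be the group of the integers j such that some
      element of M fixes x0 with slopes 2^j on the left and 1 on the right. For
      f in F and y in the orbit of x0, choose m in M with the right germ of f at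
      y; the ratio of the left slopes of f and m is 2^j with j well defined
      modulo S. This defect vanishes for all but finitely many y, and its sum
      over y is a homomorphism from F to Z/S that kills M. Its kernel is normal,
      so it is not M and must be F. Testing it on elements with a single
      defect, a chosen element of M glued to the identity at x0, gives S = Z
      ([left_slopes_all]). Hence every f in F agrees with an element of M on a
      two-sided neighbourhood of each point of (0,1) ([local_mem]).

    - To pass from neighbourhoods to compact intervals, elements of M have to be
      cut: one that is the identity on a small interval [c, x] should be
      replaced by one that agrees with it to the right of x and is the identity
      on a long interval [a, x]. Conjugation by an element of M that is the
      identity on [x, 1] and pushes a beyond c does this ([split_at]); such
      elements exist because the elements of M that are trivial on [x, 1] have
      no common fixed point in (0, x) ([fixing_no_fixed_point]). Hence every f
      in F agrees with an element of M on each compact subinterval of (0,1)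
      ([agree_interval]).

    - Let B be the normal subgroup of the elements that are the identity near 0
      and near 1. As F/B is abelian and M is not normal, B is not contained in
      M, so F = MB. Let f, g be in B. Replacing f by an element m of M and B
      that agrees with f on an interval containing both supports, and g by an
      element of M that agrees with g on a larger interval, containing also the
      support of m, does not change the commutator; so [f, g] is in M
      ([commutator_mem]). For m in M and g in B the commutator [m, g] only
      depends on m where g moves points, and there m agrees with an element of
      M in B. So B normalises M, hence F = MB does, and M is normal. *)

Set Implicit Arguments.
Unset Strict Implicit.
Unset Printing Implicit Defensive.

Import Order.TTheory GRing.Theory Num.Theory.
Import numFieldNormedType.Exports.

Local Open Scope classical_set_scope.
Local Open Scope ring_scope.

(** * Subgroups, and maximal subgroups that are normal *)

Section GroupTheory.
Variable G : groupType.
Implicit Types (H K M : set G) (x y g : G).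

Lemma subgroupP H : H 1%g -> (forall x y, H x -> H y -> H (x * y)%g) ->
  (forall x, H x -> H x^-1%g) -> subgroup H.
Proof.
move=> H1 HM HV; split; first exact/mem_set.
by move=> x y /set_mem hx /set_mem hy; apply/mem_set/HM => //; apply: HV.
Qed.

Lemma subgroup1 H : subgroup H -> H 1%g.
Proof. by move=> [/set_mem]. Qed.

Lemma subgroupM H x y : subgroup H -> H x -> H y -> H (x * y)%g.
Proof.
by move=> /group_closedM hM /mem_set hx /mem_set hy; apply/set_mem/hM.
Qed.

Lemma subgroupV H x : subgroup H -> H x -> H x^-1%g.
Proof. by move=> /group_closedV hV /mem_set hx; apply/set_mem/hV. Qed.

Definition normal_set H := forall x g, H x -> H (x ^ g)%g.

Definition zpow g (i : int) : G :=
  match i with Posz n => (g ^+ n)%g | Negz n => (g ^- n.+1)%g end.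

Lemma zpowS g i : zpow g (i + 1) = (zpow g i * g)%g.
Proof.
case: i => n; first by rewrite -PoszD addn1 /= expgSr.
case: n => [|n]; first by rewrite /= expg1 mulVg.
have -> : Negz n.+1 + 1 = Negz n by lia.
by rewrite /= (expgS g n.+1) invgM mulgVK.
Qed.

Lemma zpowB g i : zpow g (i - 1) = (zpow g i * g^-1)%g.
Proof. by rewrite -{2}(subrK 1 i) zpowS mulgK. Qed.

Lemma zpowD g (i j : int) : zpow g (i + j) = (zpow g i * zpow g j)%g.
Proof.
elim/int_ind: j => [|n IH|n IH]; first by rewrite addr0 /= mulg1.
- by rewrite -addn1 PoszD addrA zpowS IH zpowS mulgA.
- by rewrite -addn1 PoszD opprD addrA zpowB IH zpowB mulgA.
Qed.

Lemma zpowN g i : zpow g (- i) = (zpow g i)^-1%g.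
Proof. by apply: (mulIg (zpow g i)); rewrite -zpowD addNr mulVg. Qed.

Lemma zpowM g (i j : int) : zpow g (i * j) = zpow (zpow g i) j.
Proof.
elim/int_ind: j => [|n IH|n IH]; first by rewrite mulr0.
- by rewrite -addn1 PoszD mulrDr mulr1 [RHS]zpowS -IH; exact: zpowD.
- by rewrite -addn1 PoszD opprD mulrDr mulrN1 [RHS]zpowB -IH -zpowN; exact: zpowD.
Qed.

Lemma subgroup_zpow H g i : subgroup H -> H g -> H (zpow g i).
Proof.
move=> sH hg; elim/int_ind: i => [|n IH|n IH]; first exact: subgroup1.
- by rewrite -addn1 PoszD zpowS; apply: subgroupM.
- by rewrite -addn1 PoszD opprD zpowB; apply: subgroupM => //; apply: subgroupV.
Qed.

(** The subgroup generated by M and g: as M is normal, moving a power of g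
    across an element of M costs a conjugation only. *)
Lemma normal_extension_subgroup M g : subgroup M -> normal_set M ->
  subgroup [set x | exists i, M (x * zpow g i)%g].
Proof.
move=> sM nM; apply: subgroupP => /=.
- by exists 0; rewrite /= mulg1; apply: subgroup1.
- move=> x y [i hx] [j hy]; exists (j + i).
  have -> : (x * y * zpow g (j + i) =
      (x * zpow g i) * (y * zpow g j) ^ zpow g i)%g.
    by rewrite conjgE zpowD !mulgA mulgK.
  by apply: subgroupM => //; apply: nM.
- move=> x [i hx]; exists (- i).
  have -> : (x^-1 * zpow g (- i) = (x * zpow g i)^-1 ^ zpow g (- i))%g.
    by rewrite conjgE zpowN invgM invgK !mulgA mulgV mul1g.
  by apply: nM; apply: subgroupV.
Qed.

(** F/M has no proper nontrivial subgroup, so it is generated by the class of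
    any g outside M. Either g^2 is in M, or g is in the subgroup generated by M
    and g^2; in both cases a nonzero power of g is in M. *)
Lemma normal_maximal_finite_index M : maximal_subgroup M -> normal_set M ->
  ~ infinite_index M.
Proof.
move=> [sM MT maxM] nM; apply.
have gen g : ~ M g -> forall x, exists i, M (x * zpow g i)%g.
  move=> Mg x; have := maxM _ (normal_extension_subgroup g sM nM).
  case=> [y My|E|/(congr1 (@^~ x))/= ->//].
    by exists 0; rewrite /= mulg1.
  case: Mg; rewrite -E /=; exists (- 1).
  by rewrite zpowN /= mulgV; apply: subgroup1.
have [g Mg] : exists g, ~ M g.
  apply: contrapT => h; apply: MT; apply/seteqP; split=> // x _.
  by apply: contrapT => Mx; apply: h; exists x.
have [n n0 Mn] : exists2 n : int, 0 < n & M (zpow g n).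
  (* If g^2 is not in M, then M and g^2 generate G, and g = m g^(-2i) for some m
     in M. *)
  have [Mg2|Mg2] := pselect (M (zpow g 2)); first by exists 2.
  have [i] := gen _ Mg2 g; rewrite -zpowM.
  rewrite -[X in (X * _)%g](_ : zpow g 1 = _) ?expg1 // -zpowD.
  set k := 1 + 2 * i => Mk; have k0 : k != 0 by rewrite /k; lia.
  exists `|k|; first by rewrite normr_gt0.
  by case: (ger0P k) => // _; rewrite zpowN; apply: subgroupV.
have cosetE x y : M (y * x^-1)%g -> right_coset M x = right_coset M y.
  move=> h; apply/seteqP; split=> _ [m Mm <-].
    exists (m * (y * x^-1)^-1)%g; first by apply: subgroupM => //; apply: subgroupV.
    by rewrite invgM invgK mulgA mulgVK.
  by exists (m * (y * x^-1))%g; [exact: subgroupM|rewrite mulgA mulgVK].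
have : finite_set [set right_coset M (zpow g (Posz i)) | i in `I_(absz n)].
  exact/finite_image/finite_II.
apply: sub_finite_set => _ [x _ <-].
have [i hx] := gen _ Mg x.
exists (absz (- i %% n)%Z); first by rewrite /=; lia.
apply: cosetE.
set q := (- i %/ n)%Z; have Ek : Posz (absz (- i %% n)%Z) = - i - q * n.
  by rewrite gez0_abs ?modz_ge0 ?gt_eqF // {2}(divz_eq (- i) n) -/q addrC addKr.
rewrite Ek -zpowN opprB [X in zpow g X](_ : _ = i + n * q); last by ring.
rewrite zpowD mulgA; apply: subgroupM => //.
by rewrite zpowM; apply: subgroup_zpow.
Qed.

End GroupTheory.

(** * One-sided slopes of elements of F *)

Section Elements.
Variable R : realType.
Local Notation F := (thompsonF R).
Implicit Types (f g h : F) (x y : R).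

Lemma tP f : thompson_map f.
Proof. exact/asboolP/tmapP. Qed.

Lemma tmulE f g x : (f * g)%g x = g (f x). Proof. by []. Qed.

Lemma toneE x : (1%g : F) x = x. Proof. by []. Qed.

Lemma tK f : cancel f (f^-1)%g.
Proof. by move=> x; rewrite -tmulE mulgV. Qed.

Lemma tVK f : cancel (f^-1)%g f.
Proof. by move=> x; rewrite -tmulE mulVg. Qed.

Lemma tlt f : {mono f : x y / x < y}.
Proof. exact/thompson_mono/tP. Qed.

Lemma tle f : {mono f : x y / x <= y}.
Proof. by have [_ ? _ _ _] := tP f; apply: le_mono. Qed.

Lemma tinj f : injective f. Proof. exact: can_inj (tK f). Qed.

Lemma tfix f x : ~~ (0 < x < 1) -> f x = x.
Proof. exact/thompson_fix/tP. Qed.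

Lemma t0 f : f 0 = 0. Proof. by apply: tfix; rewrite ltxx. Qed.

Lemma t1 f : f 1 = 1. Proof. by apply: tfix; rewrite ltxx andbF. Qed.

Lemma t01 f x : (0 < f x < 1) = (0 < x < 1).
Proof. exact/thompson_inside/tP. Qed.

Lemma tJE f g x : (f ^ g)%g x = g (f (g^-1%g x)).
Proof. by rewrite conjgE !tmulE. Qed.

(** Germs on the right ([b = false]) and on the left ([b = true]) of x are
    treated together: [side b x t] is the point at distance t from x on that
    side. *)
Definition side (b : bool) (x t : R) := x + (-1) ^+ b * t.

Definition agree_at (b : bool) f g x := exists2 e : R, 0 < e &
  forall t : R, 0 <= t <= e -> f (side b x t) = g (side b x t).

Definition has_slope (b : bool) f x (k : int) := exists2 e : R, 0 < e &
  forall t : R, 0 <= t <= e -> f (side b x t) = side b (f x) (2 ^ k * t).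

Lemma gap_right (s : seq R) x y : x < y ->
  exists2 z, x < z <= y & {in s, forall w, w \notin `]x, z[}.
Proof.
move=> xy; elim: s => [|w s [z /andP[xz zy] IH]].
  by exists y; rewrite ?xy /=.
have [wz|wz] := boolP (w \in `]x, z[); last first.
  by exists z; rewrite ?xz // => v; rewrite inE => /orP[/eqP->|/IH].
move: wz; rewrite in_itv /= => /andP[xw wz].
exists w => [|v]; first by rewrite xw (le_trans (ltW wz)).
rewrite inE in_itv /= => /orP[/eqP->|/IH]; first by rewrite ltxx andbF.
by apply: contra => /andP[xv vw]; rewrite in_itv /= xv (lt_trans vw).
Qed.

Lemma gap_left (s : seq R) x y : y < x ->
  exists2 z, y <= z < x & {in s, forall w, w \notin `]z, x[}.
Proof.
move=> xy; elim: s => [|w s [z /andP[yz zx] IH]].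
  by exists y; rewrite ?lexx ?xy.
have [wz|wz] := boolP (w \in `]z, x[); last first.
  by exists z; rewrite ?yz // => v; rewrite inE => /orP[/eqP->|/IH].
move: wz; rewrite in_itv /= => /andP[zw wx].
exists w => [|v]; first by rewrite wx (le_trans yz) ?ltW.
rewrite inE in_itv /= => /orP[/eqP->|/IH]; first by rewrite ltxx.
by apply: contra => /andP[xv vw]; rewrite in_itv /= vw (lt_trans zw).
Qed.

Lemma interior_gap (s : seq R) x : 0 < x < 1 -> x \notin s ->
  exists p q, [/\ 0 <= p < x, x < q <= 1 &
    {in s, forall w, w \notin `]p, q[}].
Proof.
move=> /andP[x0 x1] xs.
have [p p0x pP] := gap_left s x0; have [q xq1 qP] := gap_right s x1.
exists p, q; split=> // w ws; have := pP w ws; have := qP w ws.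
have : w != x by apply: contra xs => /eqP <-.
by rewrite !in_itv /=; lra.
Qed.

(** Outside [0,1] an element is the identity, so one-sided germs exist at every
    real point; admitting all points keeps the chain rule free of side
    conditions. *)
Lemma side_gap (b : bool) (s : seq R) x :
  (exists2 e, 0 < e & forall t, 0 <= t <= e -> ~~ (0 < side b x t < 1)) \/
  exists p q, [/\ 0 <= p, p < q, q <= 1, {in s, forall w, w \notin `]p, q[} &
    exists2 e, 0 < e & forall t, 0 <= t <= e -> side b x t \in `[p, q]].
Proof.
rewrite /side; case: b; rewrite ?expr1 ?expr0.
- have [x0|x0] := lerP x 0.
    by left; exists 1 => // t t1; lra.
  have [x1|x1] := ltrP 1 x.
    by left; exists (x - 1); [lra|move=> t t1; lra].
  right; have [z /andP[z0 zx] H] := gap_left s x0.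
  exists z, x; split=> //; exists (x - z); first lra.
  by move=> t ?; rewrite in_itv /=; lra.
- have [x0|x0] := ltrP x 0.
    by left; exists (- x); [lra|move=> t t1; lra].
  have [x1|x1] := lerP 1 x.
    by left; exists 1 => // t t1; lra.
  right; have [z /andP[z0 zx] H] := gap_right s x1.
  exists x, z; split=> //; exists (z - x); first lra.
  by move=> t ?; rewrite in_itv /=; lra.
Qed.

Lemma side0 b x : side b x 0 = x. Proof. by rewrite /side mulr0 addr0. Qed.

Lemma has_slope_ex b f x : exists k, has_slope b f x k.
Proof.
have [_ _ _ _ [s _ H]] := tP f.
have [[e e0 E]|[p [q [p0 pq q1 sP [e e0 E]]]]] := side_gap b s x.
  exists 0; exists e => // t te; rewrite expr0z mul1r tfix ?E // (@tfix f x) //.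
  by rewrite -(side0 b x) E // lexx ltW.
have [k [c L]] := H p q p0 pq q1 sP; exists k; exists e => // t te.
rewrite L ?E // -{2}(side0 b x) L ?E ?lexx ?ltW //.
by rewrite /side; ring.
Qed.

Lemma has_slope_uniq b f x k l : has_slope b f x k -> has_slope b f x l -> k = l.
Proof.
move=> [e e0 E] [d d0 D]; pose m := Num.min e d.
have m0 : 0 < m by rewrite lt_min e0 d0.
have [me md] : 0 <= m <= e /\ 0 <= m <= d.
  by rewrite /m !ge_min !lexx orbT ltW.
have := E m me; rewrite D // => /addrI/(mulfI _)/= H.
have {}H : (2 : R) ^ l * m = 2 ^ k * m by apply: H; rewrite signr_eq0.
have /mulIf inj : m != 0 by rewrite gt_eqF.
have /ieexprIz := inj _ _ H.
by move=> ->; rewrite ?ltr0n ?(eqr_nat _ 2 1).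
Qed.

(** Breakpoints are dyadic, so elsewhere both one-sided slopes coincide. *)
Lemma nondyadic_has_slope f x : 0 < x < 1 -> ~ dyadic x ->
  exists k, forall b, has_slope b f x k.
Proof.
move=> x01 dx; have [_ _ _ _ [l lP H]] := tP f.
have xl : x \notin l by apply/negP => /lP[].
have [p [q [p0x xq1 pqP]]] := interior_gap x01 xl.
have [|||k [c E]] := H p q _ _ _ pqP; [lra..|].
exists k => s; exists (Num.min (x - p) (q - x)) => [|t].
  by rewrite lt_min; lra.
rewrite le_min => te; rewrite !E; first by rewrite /side; ring.
  by rewrite in_itv /=; lra.
by rewrite in_itv /= /side; case: s; rewrite ?expr0 ?expr1; lra.
Qed.

Definition log_slope b f x : int := xget 0 [set k | has_slope b f x k].

Lemma log_slopeP b f x : has_slope b f x (log_slope b f x).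
Proof.
by rewrite /log_slope; case: xgetP => // h; have [k /h] := has_slope_ex b f x.
Qed.

Lemma log_slope_eq b f x k : has_slope b f x k -> log_slope b f x = k.
Proof. exact/has_slope_uniq/log_slopeP. Qed.

Lemma nondyadic_slope f x : 0 < x < 1 -> ~ dyadic x ->
  log_slope true f x = log_slope false f x.
Proof.
by move=> x01 /(nondyadic_has_slope f x01)[k fk]; rewrite !(log_slope_eq (fk _)).
Qed.

Lemma agree_at_val b f g x : agree_at b f g x -> f x = g x.
Proof. by move=> [e e0 E]; rewrite -(side0 b x) E // lexx ltW. Qed.

Lemma agree_at_log_slope b f g x : agree_at b f g x ->
  log_slope b f x = log_slope b g x.
Proof.
move=> fg; have [e e0 E] := fg; have fgx := agree_at_val fg; apply: log_slope_eq.
have [d d0 D] := log_slopeP b g x.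
exists (Num.min e d) => [|t]; first by rewrite lt_min e0 d0.
by rewrite le_min => /and3P[t0 te td]; rewrite E ?D ?fgx ?t0.
Qed.

(** A one-sided germ of an element of F is affine, so it is determined by its
    value and its slope. *)
Lemma agree_atP b f g x :
  agree_at b f g x <-> f x = g x /\ log_slope b f x = log_slope b g x.
Proof.
split=> [h|[fg k]]; first by rewrite (agree_at_val h) (agree_at_log_slope h).
have [e e0 E] := log_slopeP b f x; have [d d0 D] := log_slopeP b g x.
exists (Num.min e d) => [|t]; first by rewrite lt_min e0 d0.
by rewrite le_min => /and3P[t0 te td]; rewrite E ?D ?t0 // fg k.
Qed.

Lemma log_slope1 b x : log_slope b (1%g : F) x = 0.
Proof. by apply: log_slope_eq; exists 1 => // t _; rewrite expr0z mul1r. Qed.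

Lemma log_slopeM b f g x :
  log_slope b (f * g)%g x = log_slope b f x + log_slope b g (f x).
Proof.
apply: log_slope_eq; have [e e0 E] := log_slopeP b f x.
have [d d0 D] := log_slopeP b g (f x).
set k := log_slope b f x in E *; set l := log_slope b g (f x) in D *.
have k0 := pow2_gt0 R k.
exists (Num.min e (d / 2 ^ k)) => [|t]; first by rewrite lt_min e0 divr_gt0.
rewrite le_min ler_pdivlMr // => /and3P[t0 te td].
rewrite !tmulE E ?t0 // D; first by rewrite addrC expfzDr ?pnatr_eq0 // mulrA.
by rewrite mulr_ge0 ?(ltW k0) //= mulrC.
Qed.

Lemma log_slopeV b f x : log_slope b f^-1%g x = - log_slope b f (f^-1%g x).
Proof. by have := log_slopeM b f^-1%g f x; rewrite mulVg log_slope1; lia. Qed.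

Lemma zpow_fix f (i : int) x : f x = x -> zpow f i x = x.
Proof.
move=> fx; elim/int_ind: i => [//|n IH|n IH].
  by rewrite -addn1 PoszD zpowS tmulE IH.
by rewrite -addn1 PoszD opprD zpowB tmulE IH -{1}fx tK.
Qed.

Lemma log_slope_zpow b f (i : int) x : f x = x ->
  log_slope b (zpow f i) x = i * log_slope b f x.
Proof.
move=> fx; have gx : f^-1%g x = x by rewrite -{1}fx tK.
elim/int_ind: i => [|n IH|n IH]; first by rewrite mul0r; exact: log_slope1.
- by rewrite -addn1 PoszD zpowS log_slopeM zpow_fix // IH; ring.
- by rewrite -addn1 PoszD opprD zpowB log_slopeM zpow_fix // IH log_slopeV gx; ring.
Qed.

End Elements.

(** * Bumps and gluing *)

Section Construct.
Variable R : realType.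
Local Notation F := (thompsonF R).
Implicit Types (f g h : F) (x y : R).

(** The image of an open interval under the inverse is an open interval. *)
Lemma increasing_bijection_continuous (f g : R -> R) :
  {homo f : x y / x < y} -> cancel f g -> cancel g f -> continuous f.
Proof.
move=> fm fK gK x; have fl := leW_mono (le_mono fm).
apply/cvgrPdist_lt => e e0; near=> t.
have h1 : g (f x - e) < t.
  by near: t; apply: lt_nbhsr; rewrite -fl gK; lra.
have h2 : t < g (f x + e).
  by near: t; apply: lt_nbhsl; rewrite -fl gK; lra.
move: h1 h2; rewrite -fl gK -(fl t) gK => h1 h2; rewrite ltr_norml; lra.
Unshelve. all: by end_near.
Qed.

Lemma thompson_mapI (f g : R -> R) : (forall x, x \notin `[0, 1] -> f x = x) ->
  {homo f : x y / x < y} -> cancel f g -> cancel g f -> dyadic_pl f ->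
  thompson_map f.
Proof.
move=> fid fm fK gK fpl.
have gm : {homo g : x y / x < y}.
  by move=> x y; rewrite -{1}(gK x) -{1}(gK y) (leW_mono (le_mono fm)).
have fc := increasing_bijection_continuous fm fK gK.
have gc := increasing_bijection_continuous gm gK fK.
by split => //; exists g.
Qed.

(** On [a, b] this is the standard generator of F rescaled from [0,1]: the
    slopes are 2, 1 and 1/2 on the first quarter, the second quarter and the
    second half. The maximum with x extends it by the identity. *)
Definition bump_fun (a b x : R) :=
  Num.max x (Num.min (2 * x - a) (Num.min (x + (b - a) / 4) ((x + b) / 2))).

Let max_minE := (@le_max _ R, @ge_max _ R, @le_min _ R, @ge_min _ R).

Lemma bump_fun_gt a b x : a < x < b -> x < bump_fun a b x.
Proof. by move=> ?; rewrite /bump_fun !(lt_max, lt_min); lra. Qed.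

Lemma bump_fun_lt a b x : a < x < b -> bump_fun a b x < b.
Proof. by move=> ?; rewrite /bump_fun !(gt_max, gt_min); lra. Qed.

Lemma bump_fun_id a b x : a < b -> x <= a \/ b <= x -> bump_fun a b x = x.
Proof.
by move=> ? ?; apply/max_idPl; rewrite !ge_min; lra.
Qed.

Lemma bump_fun1 a b x : a <= x <= a + (b - a) / 4 -> bump_fun a b x = 2 * x - a.
Proof. by move=> ?; rewrite /bump_fun; apply/eqP; rewrite eq_le !max_minE; lra. Qed.

Lemma bump_fun2 a b x : a + (b - a) / 4 <= x <= a + (b - a) / 2 ->
  bump_fun a b x = x + (b - a) / 4.
Proof. by move=> ?; rewrite /bump_fun; apply/eqP; rewrite eq_le !max_minE; lra. Qed.

Lemma bump_fun3 a b x : a + (b - a) / 2 <= x <= b -> bump_fun a b x = (x + b) / 2.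
Proof. by move=> ?; rewrite /bump_fun; apply/eqP; rewrite eq_le !max_minE; lra. Qed.

Lemma dyadic_half x : dyadic x -> dyadic (x / 2).
Proof. by move=> /(dyadicZ (- 1)); rewrite -invr_expz expr1z mulrC. Qed.

Lemma bump_map a b : 0 <= a -> a < b -> b <= 1 -> dyadic a -> dyadic b ->
  thompson_map (bump_fun a b).
Proof.
move=> a0 ab b1 da db.
(* The inverse of a minimum of increasing affine maps is the maximum of their
   inverses. *)
apply: (@thompson_mapI _ (fun y : R => Num.min y (Num.max ((y + a) / 2)
    (Num.max (y - (b - a) / 4) (2 * y - b))))).
- by move=> x; rewrite in_itv /= negb_and -!ltNge => ?; apply: bump_fun_id => //; lra.
- by move=> x y xy; rewrite /bump_fun !(lt_max, gt_max, lt_min, gt_min); lra.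
- move=> x.
  have [xa|ax] := lerP x a.
    rewrite bump_fun_id; [|lra|by left].
    by apply/eqP; rewrite eq_le !max_minE; lra.
  have [bx|xb] := lerP b x.
    rewrite bump_fun_id; [|lra|by right].
    by apply/eqP; rewrite eq_le !max_minE; lra.
  have [x1|x1] := lerP x (a + (b - a) / 4).
    by rewrite bump_fun1; [apply/eqP; rewrite eq_le !max_minE|]; lra.
  have [x2|x2] := lerP x (a + (b - a) / 2).
    by rewrite bump_fun2; [apply/eqP; rewrite eq_le !max_minE|]; lra.
  by rewrite bump_fun3; [apply/eqP; rewrite eq_le !max_minE|]; lra.
- move=> y; set g := Num.min _ _.
  have gE z : (z <= g) && (g <= z) -> g = z by move=> /le_anti ->.
  have [ya|ay] := lerP y a.
    by rewrite (gE y) ?bump_fun_id; [|lra|left|rewrite /g !max_minE; lra].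
  have [yb|yb] := lerP b y.
    by rewrite (gE y) ?bump_fun_id; [|lra|right|rewrite /g !max_minE; lra].
  have [y1|y1] := lerP y (a + (b - a) / 2).
    by rewrite (gE ((y + a) / 2)) ?bump_fun1; [|lra|rewrite /g !max_minE]; lra.
  have [y2|y2] := lerP y (a + (b - a) * 3 / 4).
    by rewrite (gE (y - (b - a) / 4)) ?bump_fun2; [|lra|rewrite /g !max_minE]; lra.
  by rewrite (gE (2 * y - b)) ?bump_fun3; [|lra|rewrite /g !max_minE]; lra.
have dl : dyadic (b - a) by apply/dyadicD/dyadicN.
pose s := [:: a; a + (b - a) / 4; a + (b - a) / 2; b].
exists [seq x <- s | 0 < x < 1].
  move=> x; rewrite mem_filter => /andP[-> xs]; split=> //.
  move: xs; rewrite !inE => /or4P[] /eqP -> //; apply: dyadicD => //.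
    by rewrite (_ : _ / 4 = (b - a) / 2 / 2); [do 2!apply: dyadic_half|field].
  exact: dyadic_half.
move=> p q p0 pq q1 H.
have {}H x : x \in s -> ~~ (p < x < q).
  move=> xs; have [x01|x01] := boolP (0 < x < 1); last by lra.
  by have := H x; rewrite mem_filter x01 xs in_itv /=; apply.
have [ha hb hc hd] : [/\ ~~ (p < a < q), ~~ (p < a + (b - a) / 4 < q),
    ~~ (p < a + (b - a) / 2 < q) & ~~ (p < b < q)].
  by split; apply: H; rewrite !inE eqxx ?orbT.
have [qa|qa] := lerP q a.
  exists 0, 0 => x; rewrite in_itv /= => ?.
  by rewrite expr0z mul1r addr0; apply: bump_fun_id => //; lra.
have [bp|bp] := lerP b p.
  exists 0, 0 => x; rewrite in_itv /= => ?.
  by rewrite expr0z mul1r addr0; apply: bump_fun_id => //; lra.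
have [q1'|q1'] := lerP q (a + (b - a) / 4).
  exists 1, (- a) => x; rewrite in_itv /= => ?.
  by rewrite expr1z; apply: bump_fun1; lra.
have [q2'|q2'] := lerP q (a + (b - a) / 2).
  exists 0, ((b - a) / 4) => x; rewrite in_itv /= => ?.
  by rewrite expr0z mul1r; apply: bump_fun2; lra.
exists (- 1), (b / 2) => x; rewrite in_itv /= => ?.
rewrite -invr_expz expr1z bump_fun3; lra.
Qed.

Definition glue_fun (c : R) (f g : R -> R) x := if x <= c then f x else g x.

Lemma glue_map (c : R) f g : 0 < c < 1 -> dyadic c -> f c = g c ->
  thompson_map (glue_fun c f g).
Proof.
move=> c01 dc fgc.
have [fid fm _ _ [s sP fs]] := tP f; have [gid gm _ _ [t stP gs]] := tP g.
have K (u v : F) : u c = v c ->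
    cancel (glue_fun c u v) (glue_fun (u c) u^-1%g v^-1%g).
  move=> uv x; rewrite /glue_fun; case: (lerP x c) => xc.
    by rewrite tle xc tK.
  by rewrite uv tle (lt_geF xc) tK.
apply: (@thompson_mapI _ (glue_fun (f c) f^-1%g g^-1%g)).
- by move=> x hx; rewrite /glue_fun fid // gid // if_same.
- move=> x y xy; rewrite /glue_fun; case: (lerP x c) => xc; case: (lerP y c) => yc.
  + exact: fm.
  + apply: (@le_lt_trans _ _ (f c)); first by rewrite tle.
    by rewrite fgc; apply: gm.
  + by have := lt_trans xc xy; rewrite ltNge yc.
  + exact: gm.
- exact: K.
- have := K f^-1%g g^-1%g; rewrite /glue_fun => K' x.
  have [xc|xc] := lerP x (f c).
    by rewrite -{1}(tVK f x) tle in xc; rewrite xc tVK.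
  by move: (xc); rewrite -{1}(tVK g x) fgc tlt ltNge => /negbTE ->; rewrite tVK.
exists (c :: s ++ t) => [x|p q p0 pq q1 H].
  rewrite inE mem_cat => /orP[/eqP-> //|/orP[/sP|/stP] //].
have [qc|qc] := lerP q c.
  have [k [d E]] : exists k d, {in `[p, q], forall x, f x = 2 ^ k * x + d}.
    by apply: fs => // x xs; apply: H; rewrite inE mem_cat xs orbT.
  exists k, d => x xpq; rewrite /glue_fun E //; case: (lerP x c) => // cx.
  by move: xpq cx; rewrite in_itv /=; lra.
have cp : c <= p.
  by have := H c; rewrite inE eqxx in_itv /= => /(_ isT); lra.
have [k [d E]] : exists k d, {in `[p, q], forall x, g x = 2 ^ k * x + d}.
  by apply: gs => // x xs; apply: H; rewrite inE mem_cat xs !orbT.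
exists k, d => x xpq; rewrite /glue_fun E //; case: (lerP x c) => // xc.
have -> : x = c by move: xpq xc; rewrite in_itv /=; lra.
by rewrite fgc E // in_itv /=; move: xpq xc; rewrite in_itv /=; lra.
Qed.

(** Made total by the default value f, taken when the glued function is not in
    F; by [glue_map] this requires f and g to differ at c, or c not to be a
    dyadic number in (0,1). *)
Definition tglue (c : R) f g : F :=
  if pselect (thompson_map (glue_fun c f g)) is left p
  then ThompsonF (asboolT p) else f.

Lemma tglueE c f g x : 0 < c < 1 -> dyadic c -> f c = g c ->
  tglue c f g x = if x <= c then f x else g x.
Proof.
by move=> c01 dc fg; rewrite /tglue; case: pselect => // -[]; apply: glue_map.
Qed.

Lemma bump_ex a b : 0 <= a -> a < b -> b <= 1 -> dyadic a -> dyadic b ->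
  exists f, forall x, f x = bump_fun a b x.
Proof.
move=> a0 ab b1 da db.
by exists (ThompsonF (asboolT (bump_map a0 ab b1 da db))).
Qed.

Lemma dyadic_between x y : x < y -> exists2 d, dyadic d & x < d < y.
Proof.
move=> xy; pose n := Num.bound (y - x)^-1.
have n0 : 0 < (2 : R) ^+ n by rewrite exprn_gt0.
have : (y - x)^-1 < 2 ^+ n by apply: upper_nthrootP; rewrite leqnn.
rewrite -[ltLHS]mul1r ltr_pdivrMr; last lra.
set N := (2 : R) ^+ n in n0 * => H.
exists ((Num.floor (x * N) + 1)%:~R / N).
  by exists (Num.floor (x * N) + 1), n.
have := floor_le_tmp (x * N); have := floorD1_gt (x * N).
rewrite ltr_pdivlMr // ltr_pdivrMr // intrD => -> h /=.
by apply: le_lt_trans (lerD h (lexx 1)) _; lra.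
Qed.

Lemma small_move x e : 0 < x < 1 -> 0 < e -> exists f, x < f x < x + e.
Proof.
move=> x01 e0.
have [a da /andP[la ua]] : exists2 d, dyadic d & Num.max 0 (x - e / 2) < d < x.
  by apply: dyadic_between; rewrite gt_max; lra.
have [b db /andP[lb ub]] : exists2 d, dyadic d & x < d < Num.min 1 (x + e / 2).
  by apply: dyadic_between; rewrite lt_min; lra.
move: la ub; rewrite gt_max lt_min => /andP[a0 ax] /andP[b1 bx].
have [f fE] : exists f, forall x, f x = bump_fun a b x by apply: bump_ex => //; lra.
have xab : a < x < b by rewrite ua.
exists f; have := bump_fun_gt xab; have := bump_fun_lt xab; rewrite fE; lra.
Qed.

Lemma bump_slopes a b f : a < b -> (forall x, f x = bump_fun a b x) ->
  [/\ log_slope false f a = 1, log_slope true f b = - 1, f a = a, f b = b &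
      forall s x, ~~ (a <= x <= b) -> log_slope s f x = 0].
Proof.
move=> ab fE.
have fa : f a = a by rewrite fE bump_fun_id //; left.
have fb : f b = b by rewrite fE bump_fun_id //; right.
split=> //.
- apply: log_slope_eq; exists ((b - a) / 4) => [|t ?]; first lra.
  by rewrite fE fa /side expr0 !mul1r expr1z bump_fun1; lra.
- apply: log_slope_eq; exists ((b - a) / 2) => [|t ?]; first lra.
  by rewrite fE fb /side expr1 -invr_expz expr1z bump_fun3; lra.
- move=> s x xab; rewrite -(log_slope1 s x); apply: agree_at_log_slope.
  have [xa|ax] := ltrP x a.
    exists (a - x) => [|t ?]; first lra.
    rewrite fE toneE bump_fun_id //; left.
    by rewrite /side; case: s; rewrite ?expr1 ?expr0; lra.
  exists (x - b) => [|t ?]; first lra.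
  rewrite fE toneE bump_fun_id //; right.
  by rewrite /side; case: s; rewrite ?expr1 ?expr0; lra.
Qed.

(** A power of the bump on [0, x], whose slope to the left of x is 1/2. *)
Lemma slope_at_dyadic x (j : int) : 0 < x < 1 -> dyadic x ->
  exists f, [/\ f x = x & log_slope true f x = j].
Proof.
move=> x01 dx.
have [f fE] : exists f, forall y, f y = bump_fun 0 x y.
  by apply: bump_ex => //; [lra..|exact: dyadic0].
have [|_ sx _ fx _] := bump_slopes _ fE; first lra.
exists (zpow f (- j)); split; first exact: zpow_fix.
by rewrite log_slope_zpow // sx; lia.
Qed.

(** A product of powers of the bumps on [0, 1/2] and [1/2, 1]. *)
Lemma ends_slopes (i j : int) :
  exists f, log_slope false f 0 = i /\ log_slope true f 1 = j.
Proof.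
have dh : dyadic (1 / 2 : R) by apply/dyadic_half/dyadic1.
have [f fE] : exists f, forall y, f y = bump_fun 0 (1 / 2) y.
  by apply: bump_ex => //; [lra..|exact: dyadic0].
have [g gE] : exists g, forall y, g y = bump_fun (1 / 2) 1 y.
  by apply: bump_ex => //; [lra..|exact: dyadic1].
have [|f0 _ ff0 _ fo] := bump_slopes _ fE; first lra.
have [|_ g1 _ gg1 go] := bump_slopes _ gE; first lra.
exists (zpow f i * zpow g (- j))%g.
rewrite !log_slopeM !zpow_fix ?t0 ?t1 // !log_slope_zpow ?t0 ?t1 //.
by rewrite f0 g1 go ?fo; [lia|lra..].
Qed.

End Construct.

(** * Elements that are piecewise in M *)

Section Piecewise.
Variable R : realType.
Local Notation F := (thompsonF R).
Variable M : set F.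
Hypothesis sM : subgroup M.
Implicit Types (f g h m : F) (x y : R).

(** The subdivision is given by the set s of its points, in any order: a piece
    is an interval without a point of s in its interior. *)
Definition piecewise : set F := [set f | exists s : seq R, forall a b : R,
  0 <= a -> a < b -> b <= 1 -> {in s, forall w, w \notin `]a, b[} ->
  exists2 m, M m & forall x, a <= x <= b -> f x = m x].

Lemma in_oo (a b x : R) : (x \in `]a, b[) = (a < x < b).
Proof. by rewrite in_itv. Qed.

Lemma sub_piecewise : M `<=` piecewise.
Proof. by move=> m Mm; exists [::] => a b *; exists m. Qed.

Lemma piecewiseV f : piecewise f -> piecewise f^-1%g.
Proof.
move=> [s fs]; exists (map f s) => a b a0 ab b1 H.
have [||||m Mm E] := fs (f^-1%g a) (f^-1%g b).
- by rewrite -(t0 f^-1%g) tle.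
- by rewrite tlt.
- by rewrite -(t1 f^-1%g) tle.
- move=> x xs; apply: contra (H (f x) (map_f _ xs)).
  by rewrite !in_oo -{1 2}[x](tK f) !tlt.
exists m^-1%g => [|y]; first exact: subgroupV.
move=> yab; apply: (@tinj _ m); rewrite tVK -E ?tVK //.
by rewrite !tle.
Qed.

Lemma piecewiseM f g : piecewise f -> piecewise g -> piecewise (f * g)%g.
Proof.
move=> [s fs] [t gt]; exists (s ++ map f^-1%g t) => a b a0 ab b1 H.
have [|m Mm E] := fs a b a0 ab b1.
  by move=> x xs; apply: H; rewrite mem_cat xs.
have [||||n Mn E'] := gt (f a) (f b).
- by rewrite -(t0 f) tle.
- by rewrite tlt.
- by rewrite -(t1 f) tle.
- move=> x xt; apply: contra (H (f^-1%g x) _).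
    by rewrite !in_oo -{1 2}[x](tVK f) !tlt.
  by rewrite mem_cat map_f ?orbT.
exists (m * n)%g => [|x xab]; first exact: subgroupM.
by rewrite !tmulE -E // E' // !tle.
Qed.

Lemma subgroup_piecewise : subgroup piecewise.
Proof.
apply: subgroupP => [|f g|f].
- exact: sub_piecewise (subgroup1 sM).
- exact: piecewiseM.
- exact: piecewiseV.
Qed.

(** Hence M is closed under gluing as soon as [piecewise M] is M. *)
Lemma piecewise_glue c f g : 0 < c < 1 -> dyadic c -> f c = g c -> M f -> M g ->
  piecewise (tglue c f g).
Proof.
move=> c01 dc fgc Mf Mg; exists [:: c] => a b a0 ab b1 H.
have [bc|cb] := lerP b c.
  exists f => // x xab; rewrite tglueE //.
  by case: (lerP x c) => //; lra.
have ca : c <= a by have := H c; rewrite inE eqxx in_itv /= => /(_ isT); lra.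
exists g => // x xab; rewrite tglueE //.
case: (lerP x c) => // xc.
by have -> : x = c by lra.
Qed.

Lemma piecewise_agree_at s f x : piecewise f -> exists2 m, M m & agree_at s f m x.
Proof.
move=> [l H].
have [[e e0 E]|[p [q [p0 pq q1 sP [e e0 E]]]]] := side_gap s l x.
  by exists 1%g; [exact: subgroup1|exists e => // t te; rewrite tfix ?E].
have [m Mm mE] := H p q p0 pq q1 sP.
exists m => //; exists e => // t te; rewrite mE //.
by have := E t te; rewrite in_itv.
Qed.

(** Only at the points of the subdivision can the two one-sided germs come from
    different elements of M. *)
Lemma piecewise_agree_both f : piecewise f ->
  exists l : seq R, forall x, 0 < x < 1 ->
  x \notin l -> exists2 m, M m & forall s, agree_at s f m x.
Proof.
move=> [l H]; exists l => x x01 xl.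
have [p [q [p0x xq1 pqP]]] := interior_gap x01 xl.
have [|||m Mm E] := H p q _ _ _ pqP; [lra..|].
exists m => // s; exists (Num.min (x - p) (q - x)) => [|t].
  by rewrite lt_min; lra.
rewrite le_min /side => te; apply: E.
by case: s; rewrite ?expr0 ?expr1; lra.
Qed.

End Piecewise.

(** * Standard dyadic intervals and reduced tree-diagrams *)

Section Words.
Variable R : realType.
Local Notation F := (thompsonF R).
Implicit Types (f g h m : F) (u v w p q : word).

Local Notation lower := (@lower R).
Local Notation upper := (@upper R).

(** The affine parametrization of [u] by [0,1]. In these terms extending words
    on the right is composition ([point_cat]), which makes linear maps between
    standard dyadic intervals compatible with extension ([carries_cat]). *)
Definition point u (t : R) := lower u + t / 2 ^+ size u.

Lemma lower_nil : lower [::] = 0. Proof. by rewrite /Defs.lower big_ord0. Qed.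

Lemma lower_cons (b : bool) u : lower (b :: u) = (b%:R + lower u) / 2.
Proof.
rewrite /Defs.lower big_ord_recl /= expr1 mulrDl; congr (_ + _).
rewrite mulr_suml; apply: eq_bigr => i _ /=.
by rewrite [2 ^+ i.+2]exprSr invfM mulrA.
Qed.

Lemma exp2_neq0 n : (2 : R) ^+ n != 0.
Proof. by rewrite expf_neq0 // pnatr_eq0. Qed.

Lemma point_nil t : point [::] t = t.
Proof. by rewrite /point lower_nil add0r expr0 divr1. Qed.

Lemma point_cons b u t : point (b :: u) t = (b%:R + point u t) / 2.
Proof. by rewrite /point lower_cons /= exprS; field; rewrite exp2_neq0. Qed.

Lemma point_cat u w t : point (u ++ w) t = point u (point w t).
Proof.
elim: u => [|b u IH] /=; first by rewrite point_nil.
by rewrite !point_cons IH.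
Qed.

Lemma point_rcons u b t : point (rcons u b) t = point u ((b%:R + t) / 2).
Proof. by rewrite -cats1 point_cat point_cons point_nil. Qed.

Lemma point_itv u t : 0 <= t <= 1 -> 0 <= point u t <= 1.
Proof.
move=> t01; elim: u => [|b u IH]; first by rewrite point_nil.
by rewrite point_cons; case: b => /=; lra.
Qed.

Lemma point_lt u t t' : (point u t < point u t') = (t < t').
Proof. by rewrite ltrD2l ltr_pM2r // invr_gt0 exprn_gt0. Qed.

Lemma point0 u : point u 0 = lower u.
Proof. by rewrite /point mul0r addr0. Qed.

Lemma point1 u : point u 1 = upper u.
Proof. by rewrite /point mul1r. Qed.

Lemma lower_itv u : 0 <= lower u < 1.
Proof.
have : point u 0 < point u 1 by rewrite point_lt.
have := point_itv u (t := 0); have := point_itv u (t := 1).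
rewrite point0; lra.
Qed.

Lemma lower_int u : exists a : int, lower u = a%:~R / 2 ^+ size u.
Proof.
elim: u => [|b u [a IH]]; first by exists 0; rewrite lower_nil mul0r.
exists (b%:R * 2 ^+ size u + a).
rewrite lower_cons IH rmorphD rmorphM rmorphXn /= exprS.
by case: b => /=; field; rewrite exp2_neq0.
Qed.

Lemma lower_dyadic u : dyadic (lower u).
Proof. by have [a ->] := lower_int u; exists a, (size u). Qed.

(** The digits of x: the first one tells on which side of 1/2 it lies. *)
Lemma word_of_dyadic (a : int) n (x : R) : x = a%:~R / 2 ^+ n -> 0 <= x < 1 ->
  exists2 v, size v = n & lower v = x.
Proof.
elim: n a x => [|n IH] a x xE x01.
  exists [::] => //; rewrite lower_nil.
  move: x01; rewrite xE expr0 divr1 -[1]/(1%:~R) ler0z ltrz1 => a01.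
  by have -> : a = 0 by lia.
have [x2|x2] := ltrP x (1 / 2).
  have [||v sv vE] := IH a (2 * x).
  - by rewrite xE exprS; field; rewrite exp2_neq0.
  - lra.
  by exists (false :: v); rewrite /= ?sv // lower_cons vE /=; lra.
have [||v sv vE] := IH (a - 2 ^+ n) (2 * x - 1).
- by rewrite xE exprS rmorphB rmorphXn /=; field; rewrite exp2_neq0.
- lra.
by exists (true :: v); rewrite /= ?sv // lower_cons vE /=; lra.
Qed.

Lemma lower_inj u v : size u = size v -> lower u = lower v -> u = v.
Proof.
elim: u v => [|b u IH] [|c v] //= [/IH{}IH].
have := lower_itv u; have := lower_itv v; rewrite !lower_cons.
case: b; case: c => /= hv hu E; try by exfalso; clear IH; lra.
- by congr (_ :: _); apply: IH => //; lra.
- by congr (_ :: _); apply: IH => //; lra.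
Qed.

Definition carries f u v := forall t, 0 <= t <= 1 -> f (point u t) = point v t.

Lemma upperB u : upper u - lower u = 2 ^- size u.
Proof. by rewrite /Defs.upper addrC addKr. Qed.

Lemma maps_linearlyP f u v : maps_linearly f u v <-> carries f u v.
Proof.
split=> [H t t01|H x].
  rewrite H; first by rewrite !upperB /point; field; rewrite !exp2_neq0.
  by rewrite in_itv /= -point0 -point1 !leNgt !point_lt -!leNgt.
rewrite in_itv /= !upperB.
have -> : x = point u ((x - lower u) * 2 ^+ size u).
  by rewrite /point; field; rewrite exp2_neq0.
set t := (_ * _).
rewrite (_ : (lower u <= point u t <= upper u) = (0 <= t <= 1)); last first.
  by rewrite -[lower u]point0 -[upper u]point1 !leNgt !point_lt.
move=> t01.
by rewrite H // /point; field; rewrite !exp2_neq0.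
Qed.

Lemma carries_cat f u v w : carries f u v -> carries f (u ++ w) (v ++ w).
Proof. by move=> H t t01; rewrite !point_cat H ?point_itv. Qed.

Lemma carriesM f g u v w : carries f u v -> carries g v w -> carries (f * g)%g u w.
Proof. by move=> fu gv t t01; rewrite tmulE fu ?gv. Qed.

Lemma carriesV f u v : carries f u v -> carries f^-1%g v u.
Proof. by move=> fu t t01; rewrite -fu ?tK. Qed.

Lemma carries1 u : carries 1%g u u. Proof. by []. Qed.

Lemma carries_inj f u v w : carries f u v -> carries f u w -> v = w.
Proof.
move=> fv fw.
have E t : 0 <= t <= 1 -> point v t = point w t by move=> t01; rewrite -fv ?fw.
have E0 : lower v = lower w by rewrite -!point0 E // lexx ler01.
apply: lower_inj => //.
have := E 1; rewrite /point E0 lexx ler01 !mul1r => /(_ isT)/addrI/invr_inj.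
by apply: ieexprIn; rewrite ?ltr0n ?(eqr_nat _ 2 1).
Qed.

Lemma carries_lower f u v : carries f u v -> f (lower u) = lower v.
Proof. by move=> H; rewrite -!point0 H // lexx ler01. Qed.

Lemma carries_node f u v : carries f (rcons u false) (rcons v false) ->
  carries f (rcons u true) (rcons v true) -> carries f u v.
Proof.
move=> H0 H1 t t01; have [t2|t2] := lerP t (1 / 2).
  have := H0 (2 * t); rewrite !point_rcons /=.
  by rewrite (_ : (0 + 2 * t) / 2 = t); [apply; lra|field].
have := H1 (2 * t - 1); rewrite !point_rcons /=.
by rewrite (_ : (1 + (2 * t - 1)) / 2 = t); [apply; lra|field].
Qed.

Definition carried f u := exists v, carries f u v.

(** If f is affine on [u], its value at the left endpoint and its slope have
    bounded denominators; so a short enough standard subinterval of [u] is mapped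
    onto an interval of length 2^-l whose endpoints are multiples of 2^-l. *)
Lemma carried_below f u (k : int) (c : R) :
  (forall t, 0 <= t <= 1 -> f (point u t) = 2 ^ k * point u t + c) ->
  exists N, forall w, (N <= size w)%N -> carried f (u ++ w).
Proof.
move=> fu.
have [a [C fa]] : dyadic (f (lower u)).
  exact/(thompson_dyadic_iff _ (tP f)).1/lower_dyadic.
exists (absz k + C)%N => w Nw.
(* f has slope 2^k, so it maps the interval of u ++ w onto one of length 2^-l. *)
pose l := absz (Posz (size w + size u) - k).
have El : Posz l = Posz (size w + size u) - k by rewrite /l; lia.
have [b lb] : exists b, l = (C + b)%N by exists (l - C)%N; lia.
clearbody l.
have El2 : (2 : R) ^ k = 2 ^+ (size w + size u) / 2 ^+ l.
  rewrite -[2 ^+ l]/(2 ^ Posz l) -[2 ^+ (size w + _)]/(2 ^ Posz _) invr_expz.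
  by rewrite -expfzDr ?pnatr_eq0 // El; congr (_ ^ _); lia.
have fE t : 0 <= t <= 1 -> f (point (u ++ w) t) =
    f (lower u) + 2 ^+ size w / 2 ^+ l * point w t.
  move=> t01; rewrite point_cat fu ?point_itv //.
  rewrite -[lower u]point0 fu ?lexx ?ler01 //.
  by rewrite El2 /point exprD; field; rewrite !exp2_neq0.
have [j wj] := lower_int w.
pose X : R := (a * 2 ^+ b + j)%:~R / 2 ^+ l.
have XE t : 0 <= t <= 1 -> f (point (u ++ w) t) = X + t / 2 ^+ l.
  move=> t01; rewrite fE // fa /X /point wj rmorphD rmorphM rmorphXn /=.
  rewrite lb exprD; field.
  by rewrite !exp2_neq0.
have X0 : 0 <= X < 1.
  have <- : f (point (u ++ w) 0) = X by rewrite XE ?lexx ?ler01 // mul0r addr0.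
  have p01 := point_itv (u ++ w) (t := 0); have p1 := point_itv (u ++ w) (t := 1).
  rewrite -[X in X <= _](t0 f) tle -[X in _ < X](t1 f) tlt.
  have : point (u ++ w) 0 < point (u ++ w) 1 by rewrite point_lt.
  lra.
have [v sv vX] := word_of_dyadic erefl X0.
by exists v => t t01; rewrite XE // /point vX sv.
Qed.

(** A standard interval shorter than the gaps between the multiples of a common
    denominator of the breakpoints has no breakpoint inside, so f is affine on
    it; the property then climbs up the binary tree. *)
Lemma carried_deep f : exists N, forall w, (N <= size w)%N -> carried f w.
Proof.
pose good u := exists N, forall w, (N <= size w)%N -> carried f (u ++ w).
have [_ _ _ _ [l lP H]] := tP f.
have [K lK] : exists K, forall x, x \in l -> exists a : int, x = a%:~R / 2 ^+ K.
  elim: l lP {H} => [|x l IH] lP; first by exists 0%N.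
  have [|K lK] := IH; first by move=> y yl; apply: lP; rewrite inE yl orbT.
  have [_ [a [n xE]]] := lP x (mem_head _ _).
  exists (n + K)%N => y; rewrite inE => /orP[/eqP->|/lK[b yE]].
    exists (a * 2 ^+ K); rewrite xE rmorphM rmorphXn /= exprD; field.
    by rewrite !exp2_neq0.
  exists (b * 2 ^+ n); rewrite yE rmorphM rmorphXn /= exprD; field.
  by rewrite !exp2_neq0.
suff : good [::] by [].
suff S n u : (K <= n + size u)%N -> good u by apply: (S K); rewrite addn0.
elim: n u => [|n IH] u.
  rewrite add0n => Ku.
  have p01 := point_itv u (t := 0); have p1 := point_itv u (t := 1).
  have [||||k [c fE]] := H (point u 0) (point u 1).
  - lra.
  - by rewrite point_lt.
  - lra.
  - move=> x /lK[a xE]; rewrite in_itv /= point0 /point.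
    have [b ->] := lower_int u.
    have -> : x = (a * 2 ^+ (size u - K))%:~R / 2 ^+ size u.
      rewrite xE rmorphM rmorphXn /= -{2}(subnKC Ku) exprD; field.
      by rewrite !exp2_neq0.
    have i0 : (0 : R) < (2 ^+ size u)^-1 by rewrite invr_gt0 exprn_gt0.
    rewrite -mulrDl !ltr_pM2r // -[1]/(1%:~R) -rmorphD /= !ltr_int; lia.
  apply: (@carried_below f u k c) => t t01.
  by apply: fE; rewrite in_itv /= !leNgt !point_lt -!leNgt.
move=> Ku; have [|N0 h0] := IH (rcons u false); first by rewrite size_rcons; lia.
have [|N1 h1] := IH (rcons u true); first by rewrite size_rcons; lia.
exists (maxn N0 N1).+1 => -[//|b w] /=; rewrite ltnS geq_max => /andP[a0 a1].
by rewrite -cat_rcons; case: b; [exact: h1|exact: h0].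
Qed.

(** The binary tree below u cut at the first words that satisfy P. The bound n
    makes the recursion structural; it has no effect when P holds for all words
    at depth n below u. *)
Fixpoint cut n (P : pred word) u : bintree :=
  if n is n'.+1 then
    if P u then Leaf else Node (cut n' P (rcons u false)) (cut n' P (rcons u true))
  else Leaf.

Lemma mem_branches_cut n (P : pred word) u w :
  (forall w, (n <= size w)%N -> P (u ++ w)) ->
  w \in branches (cut n P u) <->
  P (u ++ w) /\ forall w1 b w2, w = w1 ++ b :: w2 -> ~~ P (u ++ w1).
Proof.
elim: n u w => [|n IH] u w Pu /=.
  rewrite inE; split=> [/eqP->|[_ H]].
    by split; [exact: Pu|case].
  by case: w H => // b w /(_ [::] b w erefl); rewrite Pu.
have [Pu0|Pu0] := ifPn.
  rewrite inE; split=> [/eqP->|[_ H]]; first by rewrite cats0; split=> //; case.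
  by case: w H => // b w /(_ [::] b w erefl); rewrite cats0 Pu0.
have {}IH b w' : w' \in branches (cut n P (rcons u b)) <->
    P (u ++ b :: w') /\ forall w1 c w2, w' = w1 ++ c :: w2 -> ~~ P (u ++ b :: w1).
  rewrite -cat_rcons IH => [|v nv]; last by rewrite cat_rcons Pu.
  by split=> -[h1 h2]; split=> // w1 c w2 /h2; rewrite cat_rcons.
rewrite mem_cat; split.
  have X b w' : w = b :: w' -> w' \in branches (cut n P (rcons u b)) ->
      P (u ++ w) /\ forall w1 b w2, w = w1 ++ b :: w2 -> ~~ P (u ++ w1).
    move=> -> /IH[h1 h2]; split=> // -[|c w1] d w2 /=; first by rewrite cats0.
    by move=> [<- /h2].
  by case/orP => /mapP[w' w'P E]; exact: X E w'P.
case: w => [|b w]; first by rewrite cats0 (negbTE Pu0) => -[].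
move=> [h1 h2]; have : w \in branches (cut n P (rcons u b)).
  by apply/IH; split=> // w1 c w2 E; apply: (h2 (b :: w1) c w2); rewrite E.
by case: b {h1 h2} => /(map_f (cons _)) ->; rewrite ?orbT.
Qed.

Lemma pairwise_branches T : pairwise (fun u v => lower u < lower v) (branches T).
Proof.
elim: T => //= l IHl r IHr; rewrite pairwise_cat !pairwise_map; apply/and3P; split.
- apply/allrelP => _ _ /mapP[u _ ->] /mapP[v _ ->]; rewrite !lower_cons.
  by have := lower_itv u; have := lower_itv v => /=; lra.
- by apply: sub_pairwise IHl => u v /=; rewrite !lower_cons /=; lra.
- by apply: sub_pairwise IHr => u v /=; rewrite !lower_cons /=; lra.
Qed.

Definition carry f u : word := xget [::] [set v | carries f u v].

Lemma carryP f u : carried f u -> carries f u (carry f u).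
Proof. by move=> [v uv]; rewrite /carry; case: xgetP => // /(_ v). Qed.

Definition carriedb f : pred word := fun u => `[< carried f u >].

(** These words are the branches of the first tree of the reduced diagram of
    f. *)
Definition minimal_carried f u := carried f u /\
  forall u1 b u2, u = u1 ++ b :: u2 -> ~ carried f u1.

Lemma minimal_tree f : exists T, forall u, u \in branches T <-> minimal_carried f u.
Proof.
have [N NP] := carried_deep f; exists (cut N (carriedb f) [::]) => u.
rewrite mem_branches_cut => [|w Nw]; last exact/asboolP/NP.
split=> -[h1 h2]; split; first exact/asboolP.
- by move=> u1 b u2 /h2 /asboolP.
- exact/asboolP.
- by move=> u1 b u2 /h2 ?; apply/asboolP.
Qed.

(** Let v = v1 s, with s nonempty. If f maps some [u1] linearly onto [v1], then
    it maps [u1 s] onto [v], so u = u1 s is not minimal. Thus minimality is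
    preserved by passing to the inverse, and the two trees of the reduced
    diagram play symmetric roles. *)
Lemma minimal_carriedV f u v : carries f u v -> minimal_carried f u ->
  minimal_carried f^-1%g v.
Proof.
move=> uv [_ minu]; split; first by exists u; apply: carriesV.
move=> v1 b v2 vE [u1 /carriesV]; rewrite invgK => u1v1.
have : carries f (u1 ++ b :: v2) v by rewrite vE; apply: carries_cat.
move=> /carriesV u1v; have := carries_inj (carriesV uv) u1v.
by move=> /minu; apply; exists v1.
Qed.

(** The trees of minimal words for f and for its inverse have the same leaves
    up to f, in the same order because f is increasing. The diagram is reduced
    because two leaves with a common father in both trees would make f linear
    on the interval of the father, against minimality. *)
Lemma reduced_diagram_ex f : exists D : tree_diagram, reduced D /\
  forall uv, uv \in branch_pairs D -> carries f uv.1 uv.2.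
Proof.
have [T TP] := minimal_tree f; have [T' TP'] := minimal_tree f^-1%g.
have cP u : u \in branches T -> carries f u (carry f u).
  by move=> /TP[fu _]; apply: carryP.
have E : map (carry f) (branches T) = branches T'.
  have lt_trans' : transitive (fun u v => lower u < lower v).
    by move=> v u w; apply: lt_trans.
  apply: (irr_sorted_eq lt_trans').
  - by move=> u; rewrite /= ltxx.
  - rewrite sorted_pairwise // pairwise_map.
    apply: (@sub_in_pairwise _ (mem (branches T)) _ _ _ _ _ (pairwise_branches T)).
      move=> u v /cP uP /cP vP uv /=.
      by rewrite -(carries_lower uP) -(carries_lower vP) tlt.
    exact/allP.
  - by rewrite sorted_pairwise // pairwise_branches.
  move=> v; apply/mapP/idP => [[u uT ->]|/TP' vmin].
    by apply/TP'/(minimal_carriedV (cP u uT))/TP.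
  have [u vu] := vmin.1.
  have umin : minimal_carried f u.
    by rewrite -[f]invgK; apply: minimal_carriedV vu vmin.
  have uT : u \in branches T by apply/TP.
  exists u => //; apply: (carries_inj (f := f) (u := u)); last exact: cP.
  by rewrite -[f]invgK; apply: carriesV.
have sE : size (branches T) = size (branches T') by rewrite -E size_map.
exists (TreeDiagram sE); rewrite /reduced /branch_pairs /=; split; last first.
  move=> [u v]; rewrite -E => /= uv.
  have /(nthP ([::], [::])) [i] := uv.
  rewrite size_zip size_map minnn => ib.
  rewrite nth_zip ?size_map // (nth_map [::]) // => -[<- <-].
  by apply: cP; apply: mem_nth.
move=> [i [ib [p [pf pt]] [q [qf qt]]]].
rewrite size_zip -E size_map minnn in ib.
have ib' := ltnW ib.
move: qf qt; rewrite -E !(nth_map [::]) // pf pt => qf qt.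
have pT : rcons p false \in branches T by rewrite -pf mem_nth.
have pT' : rcons p true \in branches T by rewrite -pt mem_nth.
have := cP _ pT; have := cP _ pT'; rewrite qf qt => c1 c0.
have [_ /(_ p false [::])] := (TP _).1 pT.
by rewrite cats1 => /(_ erefl); apply; exists q; apply: carries_node.
Qed.

End Words.

(** * A subgroup closed under gluing is accepted by an automaton *)

Section Automaton.
Variable R : realType.
Local Notation F := (thompsonF R).
Variable M : set F.
Hypothesis sM : subgroup M.
Hypothesis glueM : forall (c : R) (f g : F), 0 < c < 1 -> dyadic c -> f c = g c ->
  M f -> M g -> M (tglue c f g).
Implicit Types (f g h m : F) (u v w p q : word).

(** Agreement with phi on the two halves of [u] becomes agreement on [u], by
    gluing at the midpoint. *)
Lemma glue_node (phi : R -> R) u :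
  (exists2 m, M m & forall t, 0 <= t <= 1 ->
    m (point (rcons u false) t) = phi (t / 2)) ->
  (exists2 m, M m & forall t, 0 <= t <= 1 ->
    m (point (rcons u true) t) = phi ((1 + t) / 2)) ->
  exists2 m, M m & forall t, 0 <= t <= 1 -> m (point u t) = phi t.
Proof.
move=> [m Mm m0] [n Mn n1]; pose c : R := point u (1 / 2).
have mE t : 0 <= t <= 1 / 2 -> m (point u t) = phi t.
  move=> t01; have := m0 (2 * t); rewrite point_rcons /= add0r.
  by rewrite mulrC mulfK ?pnatr_eq0 //; apply; lra.
have nE t : 1 / 2 <= t <= 1 -> n (point u t) = phi t.
  move=> t01; have := n1 (2 * t - 1); rewrite point_rcons /=.
  by rewrite (_ : (1 + (2 * t - 1)) / 2 = t); [apply; lra|field].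
have c01 : 0 < c < 1.
  have : point u 0 < c by rewrite point_lt; lra.
  have : c < point u 1 by rewrite point_lt; lra.
  have := @point_itv R u 0; have := @point_itv R u 1; lra.
have dc : dyadic c.
  apply: dyadicD; first exact: lower_dyadic.
  by exists 1, (size u).+1; rewrite exprS; field; rewrite exp2_neq0.
have mn : m c = n c by rewrite mE ?nE; lra.
exists (tglue c m n); first exact: glueM.
move=> t t01; rewrite tglueE // leNgt point_lt -leNgt.
by case: lerP => ?; [apply: mE|apply: nE]; lra.
Qed.

Lemma glue_tree (phi : R -> R) T u :
  (forall w, w \in branches T -> exists2 m, M m &
    forall t, 0 <= t <= 1 -> m (point (u ++ w) t) = phi (point (u ++ w) t)) ->
  exists2 m, M m & forall t, 0 <= t <= 1 -> m (point u t) = phi (point u t).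
Proof.
elim: T u => [|l IHl r IHr] u /= H.
  by have := H [::]; rewrite cats0; apply; rewrite inE.
have [|m Mm mE] := IHl (rcons u false).
  by move=> w wl; rewrite cat_rcons; apply: H; rewrite mem_cat map_f.
have [|n Mn nE] := IHr (rcons u true).
  by move=> w wr; rewrite cat_rcons; apply: H; rewrite mem_cat map_f ?orbT.
apply: (glue_node (phi := fun t => phi (point u t))).
  by exists m => // t t01; rewrite mE // point_rcons /= add0r.
by exists n => // t t01; rewrite nE // point_rcons.
Qed.

Definition linked u v := exists2 m, M m & carries m u v.

Lemma linked_node u v : linked (rcons u false) (rcons v false) ->
  linked (rcons u true) (rcons v true) -> linked u v.
Proof.
move=> [m Mm mE] [n Mn nE]; apply: glue_node.
  by exists m => // t t01; rewrite mE // point_rcons /= add0r.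
by exists n => // t t01; rewrite nE // point_rcons.
Qed.

Definition link_class u : set word := [set v | linked u v].

(** A vertex is a class of linked words, as a set of words: equality of
    vertices is then linkedness ([vertex_ofP]). *)
Definition link_vertex := {X : set word | exists u, X = link_class u}.

Definition vertex_of u : link_vertex := exist _ (link_class u) (ex_intro _ u erefl).

Lemma vertex_ofP u v : vertex_of u = vertex_of v <-> linked u v.
Proof.
split=> [/(congr1 (@sval _ _))/= E|[m Mm uv]].
  have : link_class v v by exists 1%g; [exact: subgroup1|exact: carries1].
  by rewrite -E.
have E : link_class u = link_class v.
  apply/seteqP; split=> w [n Mn nw].
    exists (m^-1 * n)%g; first by apply: subgroupM => //; apply: subgroupV.
    exact: carriesM (carriesV uv) nw.
  by exists (m * n)%g; [exact: subgroupM|exact: carriesM uv nw].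
exact: eq_exist.
Qed.

Lemma vertex_of_surj (x : link_vertex) : exists u, vertex_of u = x.
Proof. by case: x => X [u XE]; exists u; apply: eq_exist. Qed.

Definition word_of (x : link_vertex) : word := projT1 (cid (vertex_of_surj x)).

Lemma word_ofK x : vertex_of (word_of x) = x.
Proof. exact: projT2 (cid (vertex_of_surj x)). Qed.

Definition link_children (x : link_vertex) :=
  Some (vertex_of (rcons (word_of x) false), vertex_of (rcons (word_of x) true)).

Lemma vertex_of_rcons u b :
  vertex_of (rcons (word_of (vertex_of u)) b) = vertex_of (rcons u b).
Proof.
have /vertex_ofP[m Mm mE] := word_ofK (vertex_of u).
by apply/vertex_ofP; exists m => //; rewrite -!cats1; apply: carries_cat.
Qed.

Lemma link_childrenE u :
  link_children (vertex_of u) =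
  Some (vertex_of (rcons u false), vertex_of (rcons u true)).
Proof. by rewrite /link_children !vertex_of_rcons. Qed.

Lemma read_vertex_of u w :
  read_from link_children (vertex_of u) w = Some (vertex_of (u ++ w)).
Proof.
elim: w u => [|b w IH] u; first by rewrite cats0.
by rewrite [LHS]/= !vertex_of_rcons -cat_rcons -IH; case: b.
Qed.

(** If both children coincide, the elements of M linking them glue to an
    element linking the fathers. *)
Lemma link_fathers_distinct x1 x2 l1 r1 l2 r2 : x1 <> x2 ->
  link_children x1 = Some (l1, r1) -> link_children x2 = Some (l2, r2) ->
  l1 <> l2 \/ r1 <> r2.
Proof.
rewrite -(word_ofK x1) -(word_ofK x2) !link_childrenE => ne [<- <-] [<- <-].
apply: contrapT => /not_orP[/contrapT h0 /contrapT h1]; apply: ne.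
by apply/vertex_ofP/linked_node; apply/vertex_ofP.
Qed.

Lemma link_reachable x :
  exists u, read_from link_children (vertex_of [::]) u = Some x.
Proof. by exists (word_of x); rewrite read_vertex_of word_ofK. Qed.

Definition link_automaton := TreeAutomaton link_fathers_distinct link_reachable.

Lemma end_vertex_link u : end_vertex link_automaton u = Some (vertex_of u).
Proof. exact: read_vertex_of. Qed.

(** Every word is readable and ends at its class, so acceptance of a diagram
    says that its pairs of branches are linked. *)
Lemma glued_closed : closed_subgroup M.
Proof.
exists link_automaton; apply/seteqP; split=> f.
  move=> Mf; have [D [rD DP]] := reduced_diagram_ex f; exists D; split=> //.
    by move=> uv /DP /maps_linearlyP.
  split=> [u _|u _|uv /DP uvP]; rewrite ?/readable ?end_vertex_link.
  - by exists (vertex_of u).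
  - by exists (vertex_of u).
  - by congr Some; apply/vertex_ofP; exists f.
move=> [D [_ fD [_ _ acc]]].
have [|m Mm mE] := @glue_tree f (tplus D) [::].
  move=> u uD; have [v uv] : exists v, (u, v) \in branch_pairs D.
    have /(nthP [::])[i iu <-] := uD.
    exists (nth [::] (branches (tminus D)) i).
    rewrite /branch_pairs -nth_zip ?same_leaves // mem_nth //.
    by rewrite size_zip -same_leaves minnn.
  have := acc _ uv; rewrite !end_vertex_link => /Some_inj/vertex_ofP[m Mm mE].
  have /maps_linearlyP fE := fD _ uv.
  by exists m => // t t01; rewrite mE ?fE.
suff -> : f = m by [].
apply: thompsonF_ext => x; have [x01|x01] := boolP (0 <= x <= 1).
  by have := mE x x01; rewrite point_nil.
by rewrite !tfix //; lra.
Qed.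

End Automaton.

(** * Density of orbits *)

Section Dense.
Variable R : realType.
Local Notation F := (thompsonF R).
Implicit Types (f g h m : F) (x y : R).

(** Otherwise the supremum c of the orbit below q is at most p; an element that
    moves c to the right, but not beyond q, carries orbit points close to c
    beyond c. *)
Lemma orbit_dense_above x p q : 0 < x < q -> q <= 1 -> p < q ->
  exists f : F, p < f x < q.
Proof.
move=> /andP[x0 xq] q1 pq.
apply: contrapT => no.
pose S : set R := [set y | exists2 f : F, f x = y & y < q].
have Sp y : S y -> y <= p.
  move=> [f fx yq]; rewrite leNgt; apply/negP => py.
  by apply: no; exists f; rewrite fx py.
have Sx : S x by exists 1%g.
have hS : has_sup S by split; [exists x|exists p].
have xc : x <= sup S by apply: sup_upper_bound.
have cp : sup S <= p by apply: ge_sup => //; exists x.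
have [||f /andP[cf fc]] := @small_move _ (sup S) (q - sup S); [lra..|].
have : f^-1%g (sup S) < sup S by rewrite -(tlt f) tVK.
rewrite -subr_gt0 => lt; have [y [g gx yq]] := sup_adherent lt hS.
rewrite subKr => hy.
have yc : y <= sup S by apply: sup_upper_bound => //; exists g.
have : f y <= sup S.
  apply: sup_upper_bound => //; exists (g * f)%g; first by rewrite tmulE gx.
  by apply: le_lt_trans (_ : f (sup S) < q); [rewrite tle|lra].
apply/negP; rewrite -ltNge -[X in X < _](tVK f) tlt; lra.
Qed.

Lemma orbit_dense x p q : 0 < x < 1 -> 0 <= p -> p < q -> q <= 1 ->
  exists f : F, p < f x < q.
Proof.
move=> x01 p0 pq q1; have [xq|qx] := ltrP x q.
  by apply: orbit_dense_above => //; lra.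
have [f /andP[xf _]] : exists f : F, x < f ((p + q) / 2) < 1.
  by apply: orbit_dense_above => //; lra.
have yq : f^-1%g x < (p + q) / 2 by rewrite -(tlt f) tVK.
have y0 : 0 < f^-1%g x by have := t01 f^-1%g x; lra.
have [g gP] : exists g : F, p < g (f^-1%g x) < q.
  by apply: orbit_dense_above => //; lra.
by exists (f^-1 * g)%g.
Qed.

End Dense.

(** * Elements that are trivial near 0 and 1 *)

Section NearIdentity.
Variable R : realType.
Local Notation F := (thompsonF R).
Implicit Types (f g h m n : F) (x y a b : R).

(** The kernel of the homomorphism from F to Z^2 given by the slopes at 0 and
    1, that is, the elements that are the identity near 0 and near 1. *)
Definition ends_trivial : set F :=
  [set f | log_slope false f 0 = 0 /\ log_slope true f 1 = 0].

Lemma ends_trivial_subgroup : subgroup ends_trivial.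
Proof.
apply: subgroupP => [|f g [f0 f1] [g0 g1]|f [f0 f1]]; split;
  rewrite ?log_slope1 ?log_slopeM ?log_slopeV ?t0 ?t1 ?f0 ?f1 ?g0 ?g1 //.
Qed.

Lemma ends_trivialJ f g : ends_trivial f -> ends_trivial (f ^ g)%g.
Proof.
move=> [f0 f1]; split; rewrite conjgE !log_slopeM !log_slopeV ?(t0, t1) ?f0 ?f1; lia.
Qed.

(** F modulo [ends_trivial] embeds in Z^2. *)
Lemma ends_trivialR f g : ends_trivial [~ f, g]%g.
Proof. by split; rewrite commgEl conjgE !log_slopeM !log_slopeV ?(t0, t1); lia. Qed.

Lemma identity_near1 f : log_slope true f 1 = 0 ->
  exists2 c, 0 < c < 1 & forall y, c <= y -> f y = y.
Proof.
move=> f1; have /agree_atP[e e0 he] : f 1 = (1%g : F) 1 /\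
    log_slope true f 1 = log_slope true (1%g : F) 1.
  by rewrite t1 log_slope1.
exists (Num.max (1 / 2) (1 - e)) => [|y]; first by rewrite lt_max gt_max; lra.
rewrite ge_max => ye; have [y1|y1] := lerP y 1; last by apply: tfix; lra.
have := he (1 - y); rewrite /side expr1 toneE (_ : 1 + -1 * (1 - y) = y); last by ring.
by apply; lra.
Qed.

Lemma identity_near0 f : log_slope false f 0 = 0 ->
  exists2 c, 0 < c < 1 & forall y, y <= c -> f y = y.
Proof.
move=> f1; have /agree_atP[e e0 he] : f 0 = (1%g : F) 0 /\
    log_slope false f 0 = log_slope false (1%g : F) 0.
  by rewrite t0 log_slope1.
exists (Num.min (1 / 2) e) => [|y]; first by rewrite lt_min gt_min; lra.
rewrite le_min => ye; have [y1|y1] := lerP y 0; first by apply: tfix; lra.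
have := he y; rewrite /side expr0 toneE mul1r add0r.
by apply; lra.
Qed.

Lemma pow2_eq1 (k : int) : (2 : R) ^ k = 1 -> k = 0.
Proof.
rewrite -[RHS](expr0z 2) => /ieexprIz -> //; by rewrite ?ltr0n ?(eqr_nat _ 2 1).
Qed.

(** The supremum r of the points that h moves. The slope of h on the left of r
    is not 1, since otherwise h would be the identity near r; so h moves all
    points close to r on its left. *)
Lemma last_support h : log_slope false h 0 != 0 -> log_slope true h 1 = 0 ->
  exists r,
  [/\ 0 < r < 1, forall y, r <= y -> h y = y &
      exists2 q, q < r & forall y, q < y < r -> h y != y].
Proof.
move=> h0 h1; pose S : set R := [set y | h y != y].
have [c c01 hc] := identity_near1 h1.
have Se y : h y != y -> y <= c.
  by move=> Sy; rewrite leNgt; apply/negP => cy; case/negP: Sy; apply/eqP/hc; lra.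
have [y Sy y0] : exists2 y, h y != y & 0 < y.
  have [d d0 hd] := log_slopeP false h 0.
  exists d => //; have := hd d.
  rewrite /side expr0 !mul1r t0 !add0r => ->; last lra.
  apply/negP => /eqP E; case/negP: h0; apply/eqP/pow2_eq1.
  have d1 : d != 0 by rewrite gt_eqF.
  by apply: (mulIf d1); rewrite mul1r.
have hS : has_sup S by split; [exists y|exists c].
have Sr z : h z != z -> z <= sup S by move=> ?; apply: sup_upper_bound.
have r0 : 0 < sup S by have := Sr y Sy; lra.
have r1 : sup S <= c by apply: ge_sup => //; exists y.
set r := sup S in Sr r0 r1 *.
have fixr z : r < z -> h z = z.
  move=> rz; apply/eqP; apply: contraT => /Sr; lra.
have hr : h r = r.
  have [d d0 hd] := log_slopeP false h r.
  have E t : 0 < t <= d -> r + t = h r + 2 ^ log_slope false h r * t.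
    move=> /andP[t0' td]; have := hd t; rewrite /side expr0 !mul1r.
    by rewrite fixr; [apply; lra|lra].
  have := E d; have := E (d / 2); lra.
exists r; split; first lra.
  by move=> z; rewrite le_eqVlt => /orP[/eqP<-|/fixr].
have [d d0 hd] := log_slopeP true h r.
have [k0|k0] := eqVneq (log_slope true h r) 0.
  suff : r <= r - d by lra.
  apply: ge_sup; first by exists y.
  move=> z; rewrite [S z]/= => Sz; have zr := Sr z Sz.
  rewrite leNgt; apply/negP => dz; case/negP: Sz; apply/eqP.
  have := hd (r - z); rewrite k0 expr0z mul1r /side expr1 hr.
  by rewrite (_ : r + -1 * (r - z) = z); [move=> ->//; lra|ring].
exists (r - d) => [|z zr]; first lra.
have := hd (r - z); rewrite /side expr1 hr (_ : r + -1 * (r - z) = z); last by ring.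
move=> ->; last lra.
apply/negP => /eqP E; case/negP: k0; apply/eqP/pow2_eq1.
have : (2 ^ log_slope true h r - 1) * (r - z) = 0 by lra.
by move/eqP; rewrite mulf_eq0 => /orP[]/eqP; lra.
Qed.

Definition identity_off f a b := forall y, y <= a \/ b <= y -> f y = y.

Lemma identity_off_sub f a b a' b' : a' <= a -> b <= b' ->
  identity_off f a b -> identity_off f a' b'.
Proof. by move=> aa bb fo y [ya|yb]; apply: fo; [left|right]; lra. Qed.

Lemma ends_trivialP f : ends_trivial f ->
  exists a b, [/\ 0 < a, a <= b, b < 1 & identity_off f a b].
Proof.
move=> [/identity_near0[a a01 fa] /identity_near1[b b01 fb]].
exists a, (Num.max a b); rewrite gt_max le_max lexx; split=> //; first lra.
  lra.
by move=> y []; [exact: fa|rewrite ge_max => /andP[_ /fb]].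
Qed.

Lemma fixV f y : f y = y -> f^-1%g y = y.
Proof. by move=> fy; rewrite -{1}fy tK. Qed.

Lemma fix_itv f a b y : f a = a -> f b = b -> (a <= f y <= b) = (a <= y <= b).
Proof. by move=> fa fb; rewrite -{1}fa -{1}fb !tle. Qed.

(** On [a, b] all four steps of the commutator agree. Off [a, b] the left-hand
    side is trivial, and so is the right-hand side: the sets [a1, a], [b, b1]
    and the complement of [a1, b1] are preserved by m and by n, and on each of
    them m or n is the identity. *)
Lemma commutator_agree f g m n a b a1 b1 : a1 <= a -> a <= b -> b <= b1 ->
  identity_off f a b -> identity_off g a b -> identity_off m a1 b1 ->
  (forall y, a <= y <= b -> f y = m y) ->
  (forall y, a1 <= y <= b1 -> g y = n y) -> [~ f, g]%g = [~ m, n]%g.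
Proof.
move=> a1a ab bb1 fo go mo fm gn; apply: thompsonF_ext => z.
have fa : f a = a by apply: fo; left.
have fb : f b = b by apply: fo; right.
have ga : g a = a by apply: go; left.
have gb : g b = b by apply: go; right.
have ma1 : m a1 = a1 by apply: mo; left.
have mb1 : m b1 = b1 by apply: mo; right.
have ma : m a = a by rewrite -fm ?lexx.
have mb : m b = b by rewrite -fm ?lexx ?andbT.
have na1 : n a1 = a1 by rewrite -gn ?lexx ?andTb; [apply: go; left|lra].
have nb1 : n b1 = b1 by rewrite -gn ?lexx ?andbT; [apply: go; right|lra].
rewrite !commgEl !conjgE !tmulE.
have [zab|zab] := boolP (a <= z <= b).
  have E1 : f^-1%g z = m^-1%g z.
    by apply: (@tinj _ m); rewrite tVK -fm ?tVK // fix_itv ?fixV.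
  have z1 : a <= m^-1%g z <= b by rewrite fix_itv ?fixV.
  rewrite E1; have E2 : g^-1%g (m^-1%g z) = n^-1%g (m^-1%g z).
    apply: (@tinj _ n); rewrite tVK -gn ?tVK //.
    have : a <= g^-1%g (m^-1%g z) <= b by rewrite (fix_itv _ (fixV ga) (fixV gb)).
    by lra.
  have z2 : a <= n^-1%g (m^-1%g z) <= b.
    by rewrite -E2 (fix_itv _ (fixV ga) (fixV gb)).
  rewrite E2 fm // gn //.
  have : a <= m (n^-1%g (m^-1%g z)) <= b by rewrite fix_itv.
  by lra.
have zo : z <= a \/ b <= z by lra.
rewrite (fixV (fo _ zo)) (fixV (go _ zo)) (fo _ zo) (go _ zo).
have [z1|z1] := boolP (a1 <= z <= b1); last first.
  have zo1 : z <= a1 \/ b1 <= z by lra.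
  rewrite (fixV (mo _ zo1)) mo ?tVK //.
  have : ~~ (a1 <= n^-1%g z <= b1) by rewrite (fix_itv _ (fixV na1) (fixV nb1)).
  by lra.
have w1 : a1 <= m^-1%g z <= b1 by rewrite fix_itv ?fixV.
have wo : m^-1%g z <= a \/ b <= m^-1%g z.
  have : ~~ (a <= m^-1%g z <= b) by rewrite (fix_itv _ (fixV ma) (fixV mb)).
  by lra.
rewrite (fixV (_ : n (m^-1%g z) = _)) ?tVK; first by rewrite -gn // go.
by rewrite -gn // go.
Qed.

(** The commutator is the conjugate of the inverse of f by m, times f; the
    conjugate only depends on m on the support of f. *)
Lemma commutator_agree_conj m (t : F) f a b : a <= b -> identity_off f a b ->
  (forall y, a <= y <= b -> t y = m y) -> [~ m, f]%g = [~ t, f]%g.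
Proof.
move=> ab fo tm; apply: thompsonF_ext => z.
rewrite !commgEl !conjgE !tmulE; congr (f _).
have fa : f a = a by apply: fo; left.
have fb : f b = b by apply: fo; right.
have [wab|wab] := boolP (a <= m^-1%g z <= b).
  have -> : t^-1%g z = m^-1%g z by apply: (@tinj _ t); rewrite tVK tm // tVK.
  by rewrite tm // (fix_itv _ (fixV fa) (fixV fb)).
rewrite (fixV (_ : f (m^-1%g z) = _)) ?tVK; last by apply: fo; lra.
rewrite (fixV (_ : f (t^-1%g z) = _)) ?tVK //; apply: fo.
suff : ~~ (a <= t^-1%g z <= b) by lra.
apply: contra wab => h; suff -> : m^-1%g z = t^-1%g z by [].
by apply: (@tinj _ m); rewrite tVK -tm // tVK.
Qed.

End NearIdentity.

(** * The defect homomorphism *)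

Lemma big_support (T : eqType) (V : zmodType) (l l' : seq T) (J : T -> V) :
  uniq l -> uniq l' -> {subset l <= l'} ->
  {in l', forall y, y \notin l -> J y = 0} ->
  \sum_(y <- l') J y = \sum_(y <- l) J y.
Proof.
move=> ul ul' ll' J0; rewrite [RHS](perm_big [seq y <- l' | y \in l]); last first.
  rewrite perm_sym; apply: uniq_perm; rewrite ?filter_uniq // => y.
  by rewrite mem_filter; case yl : (y \in l) => //=; rewrite ll'.
rewrite big_filter [RHS]big_mkcond; apply: eq_big_seq => y yl' /=.
by case: ifPn => // /J0 ->.
Qed.

Section MaximalSubgroup.
Variable R : realType.
Local Notation F := (thompsonF R).
Variable M : set F.
Hypothesis maxM : maximal_subgroup M.
Hypothesis nnM : ~ normal_set M.
Hypothesis pwT : piecewise M = setT.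
Implicit Types (f g h m n : F) (x y : R).

Let sM : subgroup M. Proof. by case: maxM. Qed.

Lemma germ_mem s f x : exists2 m, M m & agree_at s f m x.
Proof. by apply: piecewise_agree_at; rewrite ?pwT. Qed.

Section Obstruction.
Variable x0 : R.
Hypothesis x001 : 0 < x0 < 1.
Hypothesis dx0 : dyadic x0.

(** The group S of the two-sided germs of M at x0 that are trivial on the
    right, read on the left. *)
Definition left_slopes (j : int) := exists m,
  [/\ M m, m x0 = x0, log_slope false m x0 = 0 & log_slope true m x0 = j].

Definition orb y := exists2 m, M m & m x0 = y.

(** The obstruction, modulo S, to finding an element of M that agrees with f on
    both sides of y. *)
Definition defect f y (j : int) :=
  exists2 m, M m & agree_at false f m y /\
    j = log_slope true f y - log_slope true m y.

Lemma left_slopes0 : left_slopes 0.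
Proof. by exists 1%g; split; rewrite ?log_slope1 //; apply: subgroup1. Qed.

Lemma left_slopesD i j : left_slopes i -> left_slopes j -> left_slopes (i + j).
Proof.
move=> [m [Mm mx m0 mi]] [n [Mn nx n0 nj]]; exists (m * n)%g.
by split; rewrite ?tmulE ?log_slopeM ?mx ?m0 ?n0 ?mi ?nj //; apply: subgroupM.
Qed.

Lemma left_slopesN i : left_slopes i -> left_slopes (- i).
Proof.
move=> [m [Mm mx m0 mi]]; have mVx : m^-1%g x0 = x0 by rewrite -{1}mx tK.
by exists m^-1%g; split; rewrite ?log_slopeV ?mVx ?m0 ?mi //; apply: subgroupV.
Qed.

Lemma left_slopesB i j : left_slopes i -> left_slopes j -> left_slopes (i - j).
Proof. by move=> hi hj; apply: left_slopesD => //; apply: left_slopesN. Qed.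

Lemma orb_01 y : orb y -> 0 < y < 1.
Proof. by move=> [m _ <-]; rewrite t01. Qed.

Lemma orb_image f y : orb y -> orb (f y).
Proof.
move=> [t Mt ty]; have [m Mm /agree_at_val ->] := germ_mem true f y.
by exists (t * m)%g; [exact: subgroupM|rewrite tmulE ty].
Qed.

Lemma defect_ex f y : exists j, defect f y j.
Proof.
have [m Mm fm] := germ_mem false f y.
by exists (log_slope true f y - log_slope true m y), m.
Qed.

(** Two elements of M with the same right germ at y differ by an element that
    fixes y with right slope 1; a conjugation by an element of M moves y to x0
    without changing slopes. *)
Lemma defect_uniq f y i j : orb y -> defect f y i -> defect f y j ->
  left_slopes (i - j).
Proof.
move=> [t Mt ty] [m Mm [/agree_atP[fm sfm] ->]] [n Mn [/agree_atP[fn sfn] ->]].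
have E : m^-1%g (n y) = y by rewrite -fn fm tK.
have tE : t^-1%g y = x0 by rewrite -ty tK.
exists (t * (n * m^-1) * t^-1)%g; split.
- by do !(apply: subgroupM || apply: subgroupV).
- by rewrite !tmulE ty E.
- by rewrite !log_slopeM !log_slopeV !tmulE ty E tE; lia.
- by rewrite !log_slopeM !log_slopeV !tmulE ty E tE; lia.
Qed.

Lemma defect_mem m y : M m -> defect m y 0.
Proof. by move=> Mm; exists m => //; split; [apply/agree_atP|rewrite subrr]. Qed.

Lemma defect_both f m y : M m -> (forall s, agree_at s f m y) -> defect f y 0.
Proof.
move=> Mm fm; exists m => //; split => //.
by rewrite (agree_at_log_slope (fm true)) subrr.
Qed.

Lemma defectM f g y i j : defect f y i -> defect g (f y) j ->
  defect (f * g)%g y (i + j).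
Proof.
move=> [m Mm [/agree_atP[fm sfm] ->]] [n Mn [/agree_atP[gn sgn] ->]].
exists (m * n)%g; first exact: subgroupM.
split; last by rewrite !log_slopeM -fm; lia.
by apply/agree_atP; rewrite !log_slopeM !tmulE -fm gn sfm sgn.
Qed.

(** Sums of defects are taken over a finite list l containing every point at
    which the chosen representative J is nonzero. Modulo S the value does not
    depend on the choices ([total_defect_uniq]). *)
Definition total_defect f (j : int) := exists (J : R -> int) (l : seq R),
  [/\ uniq l, {in l, forall y, orb y}, forall y, orb y -> defect f y (J y),
      forall y, orb y -> y \notin l -> J y = 0 & j = \sum_(y <- l) J y].

Lemma total_defect_ex f : exists j, total_defect f j.
Proof.
have [|l lP] := @piecewise_agree_both _ M f; first by rewrite pwT.
pose l' := undup [seq y <- l | `[< orb y >]].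
pose J y := if y \in l' then xget 0 [set j | defect f y j] else 0.
exists (\sum_(y <- l') J y), J, l'; split => //.
- exact: undup_uniq.
- by move=> y; rewrite mem_undup mem_filter => /andP[/asboolP].
- move=> y oy; rewrite /J; case: ifPn => [_|].
    by case: xgetP => // h; have [j /h] := defect_ex f y.
  rewrite mem_undup mem_filter; move/asboolP: (oy) => -> /= yl.
  by have [m Mm fm] := lP y (orb_01 oy) yl; apply: defect_both fm.
- by move=> y _; rewrite /J => /negbTE ->.
Qed.

Lemma total_defect_mem m : M m -> total_defect m 0.
Proof.
move=> Mm; exists (fun=> 0), [::]; split=> // [y _|].
  exact: defect_mem.
by rewrite big_nil.
Qed.

Lemma total_defect_uniq f i j : total_defect f i -> total_defect f j ->
  left_slopes (i - j).
Proof.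
move=> [J [l [ul ol JP J0 ->]]] [K [l' [ul' ol' KP K0 ->]]].
pose l2 := undup (l ++ l').
have o2 y : y \in l2 -> orb y.
  by rewrite mem_undup mem_cat => /orP[/ol|/ol'].
rewrite -(@big_support _ _ l l2) ?undup_uniq //; first last.
- by move=> y /o2 /J0.
- by move=> y yl; rewrite mem_undup mem_cat yl.
rewrite -(@big_support _ _ l' l2) ?undup_uniq //; first last.
- by move=> y /o2 /K0.
- by move=> y yl; rewrite mem_undup mem_cat yl orbT.
rewrite -sumrB big_seq; apply: (big_ind left_slopes).
- exact: left_slopes0.
- exact: left_slopesD.
- by move=> y /o2 oy; apply: (@defect_uniq f y) => //; [exact: JP|exact: KP].
Qed.

(** Defects add up along the chain rule; the sum of the defects of g over the
    points f y is its total defect because f permutes the orbit of x0. *)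
Lemma total_defectM f g i j : total_defect f i -> total_defect g j ->
  total_defect (f * g)%g (i + j).
Proof.
move=> [J [l [ul ol JP J0 ->]]] [K [l' [ul' ol' KP K0 ->]]].
pose l2 := undup (l ++ map f^-1%g l').
have o2 y : y \in l2 -> orb y.
  rewrite mem_undup mem_cat => /orP[/ol//|/mapP[z /ol' oz ->]].
  exact: orb_image.
exists (fun y => J y + K (f y)), l2; split.
- exact: undup_uniq.
- exact: o2.
- by move=> y oy; apply: defectM; [exact: JP|apply: KP; exact: orb_image].
- move=> y oy; rewrite mem_undup mem_cat negb_or => /andP[yl yl'].
  rewrite J0 // K0 ?addr0 //; first exact: orb_image.
  by apply: contra yl' => /(map_f f^-1%g); rewrite tK.
- rewrite big_split; congr (_ + _).
    apply/esym/big_support; rewrite ?undup_uniq //; last by move=> y /o2 /J0.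
    by move=> y yl; rewrite mem_undup mem_cat yl.
  rewrite -(big_map f xpredT K); apply/esym/big_support => //.
  + by rewrite map_inj_uniq ?undup_uniq //; exact: tinj.
  + move=> y yl; rewrite -[y](tVK f) map_f // mem_undup mem_cat map_f ?orbT //.
  + by move=> _ /mapP[z /o2 oz ->]; apply: K0; apply: orb_image.
Qed.

Definition defect_kernel : set F :=
  [set f | exists2 j, total_defect f j & left_slopes j].

Lemma total_defectV f i j : total_defect f i -> total_defect f^-1%g j ->
  left_slopes (i + j).
Proof.
move=> fi fj; have h := total_defectM fi fj; rewrite mulgV in h.
rewrite -[i + j]subr0; apply: (total_defect_uniq h).
by apply: total_defect_mem; apply: subgroup1.
Qed.

(** The kernel of the total defect is normal and contains M, which is maximal
    and not normal. *)
Lemma defect_kernel_total : defect_kernel = setT.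
Proof.
have kM : M `<=` defect_kernel.
  by move=> m Mm; exists 0; [exact: total_defect_mem|exact: left_slopes0].
have kJ : normal_set defect_kernel.
  move=> f g [j fj Sj]; have [i gi] := total_defect_ex g.
  have [k gk] := total_defect_ex g^-1%g.
  exists (k + (j + i)); first by rewrite conjgE; do !apply: total_defectM.
  rewrite (_ : _ + _ = j + (i + k)); last by ring.
  by apply: left_slopesD => //; apply: total_defectV gk.
have sk : subgroup defect_kernel.
  apply: subgroupP.
  - exact: kM (subgroup1 sM).
  - move=> f g [i fi Si] [j gj Sj]; exists (i + j); first exact: total_defectM.
    exact: left_slopesD.
  - move=> f [i fi Si]; have [j fj] := total_defect_ex f^-1%g.
    exists j => //; rewrite -(addKr i j) addrC; apply: left_slopesB => //.
    exact: total_defectV fj.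
have [_ _ h] := maxM; case: (h _ sk kM) => // E.
by case: nnM; rewrite -E.
Qed.

(** Let g in M fix x0 with left slope 2^j. The element k that is g on the left
    of x0 and the identity on its right agrees near every other point with g or
    with the identity, so its total defect is j; as it must vanish modulo S, j is
    in S. *)
Lemma left_slopes_all j : left_slopes j.
Proof.
have [f [fx fj]] := slope_at_dyadic j x001 dx0.
have [g Mg gf] := germ_mem true f x0.
move: gf fx fj => /agree_atP[-> ->] gx gj.
have gE := @tglueE _ x0 g 1%g _ x001 dx0 gx.
pose k := tglue x0 g 1%g.
have kl y : y <= x0 -> k y = g y by rewrite gE => ->.
have kr y : x0 <= y -> k y = y.
  by rewrite gE toneE; case: ltgtP => // <- _.
have kx : k x0 = x0 by rewrite kr.
have kd : total_defect k j.
  exists (fun y => if y == x0 then j else 0), [:: x0]; split => //.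
  - by move=> y; rewrite inE => /eqP->; exists 1%g; [exact: subgroup1|].
  - move=> y oy; case: eqVneq => [->|yx].
      exists 1%g; [exact: subgroup1|split].
        by exists 1 => // t /andP[t0_ _]; rewrite kr // /side expr0 mul1r lerDl.
      rewrite log_slope1 subr0 -gj; apply/esym/agree_at_log_slope.
      exists 1 => // t te.
      by rewrite kl // /side expr1; lra.
    have [yl|ly] := ltrP y x0.
      apply: (defect_both Mg) => s; exists (x0 - y) => [|t te]; first lra.
      by rewrite kl // /side; case: s; rewrite ?expr1 ?expr0; lra.
    apply: (@defect_both _ 1%g); first exact: subgroup1.
    move=> s; exists (y - x0) => [|t te]; first by move/eqP: yx; lra.
    by rewrite kr // /side; case: s; rewrite ?expr1 ?expr0; lra.
  - by move=> y _; rewrite inE => /negbTE->.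
  - by rewrite big_seq1 eqxx.
have : defect_kernel k by rewrite defect_kernel_total.
move=> [i ki Si]; rewrite -(subrK i j); apply: left_slopesD => //.
exact: total_defect_uniq ki.
Qed.

End Obstruction.

(** * Pushing points and cutting elements of M *)

(** Otherwise M would contain [ends_trivial], hence all commutators, and would
    be normal. *)
Lemma maximal_mul_ends f : exists m b, [/\ M m, ends_trivial b & f = (m * b)%g].
Proof.
have sB := ends_trivial_subgroup.
pose K : set F := [set f | exists m b, [/\ M m, ends_trivial b & f = (m * b)%g]].
have MK : M `<=` K.
  by move=> m Mm; exists m, 1%g; split=> //; [exact: subgroup1|rewrite mulg1].
have sK : subgroup K.
  apply: subgroupP.
  - exact: MK (subgroup1 sM).
  - move=> _ _ [m [b [Mm Bb ->]]] [n [c [Mn Bc ->]]].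
    exists (m * n)%g, (b ^ n * c)%g; split; first exact: subgroupM.
      by apply: subgroupM => //; apply: ends_trivialJ.
    by rewrite conjgE !mulgA mulgK.
  - move=> _ [m [b [Mm Bb ->]]]; exists m^-1%g, (b^-1 ^ m^-1)%g; split.
    + exact: subgroupV.
    + by apply: ends_trivialJ; apply: subgroupV.
    + by rewrite conjgE invgK invgM !mulgA mulVg mul1g.
have [_ _ h] := maxM; case: (h _ sK MK) => [E|E]; last first.
  by have : K f by rewrite E.
case: nnM => m g Mm.
have -> : (m ^ g = m * [~ m, g])%g by rewrite commgEl mulVKg.
apply: subgroupM => //; rewrite -E; exists 1%g, [~ m, g]%g.
by split; [exact: subgroup1|exact: ends_trivialR|rewrite mul1g].
Qed.

Lemma ends_slopes_mem i j :
  exists m, [/\ M m, log_slope false m 0 = i & log_slope true m 1 = j].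
Proof.
have [f [fi fj]] := ends_slopes R i j.
have [m [b [Mm [b0 b1] E]]] := maximal_mul_ends f.
exists m; split=> //.
- by rewrite -fi E log_slopeM t0 b0 addr0.
- by rewrite -fj E log_slopeM t1 b1 addr0.
Qed.

(** At a dyadic point an element of M with the right germ of f is corrected on
    the left by [left_slopes_all]; at other points both germs have the same
    slope already. *)
Lemma local_mem f x : 0 < x < 1 -> exists m e,
  [/\ M m, 0 < e & forall y, x - e <= y <= x + e -> f y = m y].
Proof.
move=> x01.
have [m Mm fm] : exists2 m, M m & forall s, agree_at s f m x.
  have [m Mm /agree_atP[fm sfm]] := germ_mem false f x.
  have [E|E] := eqVneq (log_slope true f x) (log_slope true m x).
    by exists m => // -[]; apply/agree_atP.
  have [dx|dx] := pselect (dyadic x); last first.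
    by case/eqP: E; rewrite !nondyadic_slope.
  have [n [Mn nx n0 nj]] :=
    left_slopes_all x01 dx (log_slope true f x - log_slope true m x).
  exists (n * m)%g; first exact: subgroupM.
  case; apply/agree_atP; rewrite tmulE log_slopeM nx ?n0 ?nj fm ?sfm.
    by rewrite subrK.
  by rewrite add0r.
have [e e0 He] := fm true; have [d d0 Hd] := fm false.
exists m, (Num.min e d); split=> // [|y]; first by rewrite lt_min e0 d0.
have [yx|xy] := lerP y x => h.
  have := He (x - y); rewrite /side expr1 (_ : x + -1 * (x - y) = y); last by ring.
  by apply; have : Num.min e d <= e by [rewrite ge_min lexx]; lra.
have := Hd (y - x); rewrite /side expr0 (_ : x + 1 * (y - x) = y); last by ring.
by apply; have : Num.min e d <= d by [rewrite ge_min lexx orbT]; lra.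
Qed.

(** Orbits of M and of F coincide, since f agrees with an element of M at each
    single point. *)
Lemma orbit_dense_mem x p q : 0 < x < 1 -> 0 <= p -> p < q -> q <= 1 ->
  exists2 m, M m & p < m x < q.
Proof.
move=> x01 p0 pq q1; have [f fx] := orbit_dense x01 p0 pq q1.
have [m Mm /agree_at_val fm] := germ_mem true f x.
by exists m => //; rewrite -fm.
Qed.

Definition fixing (b : R) : set F := [set m | M m /\ forall y, b <= y -> m y = y].

Lemma fixingM b m n : fixing b m -> fixing b n -> fixing b (m * n)%g.
Proof.
move=> [Mm mb] [Mn nb]; split; first exact: subgroupM.
by move=> y yb; rewrite tmulE mb ?nb.
Qed.

Lemma fixingV b m : fixing b m -> fixing b m^-1%g.
Proof.
move=> [Mm mb]; split; first exact: subgroupV.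
by move=> y yb; rewrite -[in LHS](mb y) ?tK.
Qed.

Lemma fixingJ b m t : M t -> fixing b m -> fixing (t b) (m ^ t)%g.
Proof.
move=> Mt [Mm mb]; split.
  by rewrite conjgE; do !(apply: subgroupM || apply: subgroupV).
by move=> y yb; rewrite tJE mb ?tVK // -(tle t) tVK.
Qed.

(** The right end of the support of an element of M that is nontrivial near 0.
    The choice is flexible: by [fixingJ] all points of the M-orbit of r behave
    like r, and this orbit is dense. *)
Definition support_end r := exists h, [/\ M h, log_slope false h 0 != 0, 0 < r < 1,
  forall y, r <= y -> h y = y & exists2 q, q < r & forall y, q < y < r -> h y != y].

Definition fixedpt b p := forall m, fixing b m -> m p = p.

Lemma fixedptJ b p t : M t -> fixedpt b p -> fixedpt (t b) (t p).
Proof.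
move=> Mt bp m bm; have /bp : fixing b (m ^ t^-1)%g.
  by rewrite -[b](tK t); apply: fixingJ => //; apply: subgroupV.
by rewrite tJE invgK => /(congr1 t); rewrite tVK.
Qed.

(** Suppose that the elements of [fixing r] have a common fixed point in (0, r),
    and let z be the least one; it exists because the element h of M provided by
    [support_end r] belongs to [fixing r] and moves all points near 0. Translate
    z by t in M into an interval to the left of r and to the right of z on which
    h has no fixed point; then [t z] is the least positive common fixed point of
    [fixing (t r)]. If r <= t r, then h is in [fixing (t r)] but moves [t z]. If
    t r < r, then [fixing (t r)] is contained in [fixing r] and fixes z, which
    is less than [t z]. *)
Lemma fixing_no_fixed_point r p : support_end r -> 0 < p < r ->
  exists2 m, fixing r m & m p != p.
Proof.
move=> [h [Mh h0 r01 hr hq]] p0r; apply: contrapT => no.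
have {no} fp : fixedpt r p.
  by move=> m rm; apply/eqP; apply: contraT => mp; case: no; exists m.
have hfix : fixing r h by [].
pose S : set R := [set y | 0 < y /\ fixedpt r y].
have [e e0 he] := log_slopeP false h 0.
have Se y : S y -> e <= y.
  move=> [y0 fy]; rewrite leNgt; apply/negP => ye.
  have := he y; rewrite /side expr0 !mul1r t0 !add0r fy // => E.
  have {}E : y = 2 ^ log_slope false h 0 * y by apply: E; lra.
  case/negP: h0; apply/eqP/pow2_eq1.
  have yn : y != 0 by rewrite gt_eqF.
  by apply: (mulIf yn); rewrite mul1r -E.
have Sp : S p by split=> //; case/andP: p0r.
have hS : has_inf S by split; [exists p|exists e].
have lbS y : S y -> inf S <= y by move=> ?; apply: inf_lbound => //; case: hS.
have ze : e <= inf S by apply: lb_le_inf => //; exists p.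
have zp : inf S <= p by apply: lbS.
set z := inf S in lbS ze zp *.
have up m : fixing r m -> m z <= z.
  move=> rm; rewrite leNgt; apply/negP; rewrite -subr_gt0 => mz.
  have [y [y0 fy]] := inf_adherent mz hS; rewrite addrC subrK => ymz.
  have : m z <= m y by rewrite tle lbS.
  by rewrite fy //; lra.
have fz : fixedpt r z.
  move=> m rm; apply/eqP; rewrite eq_le up //=.
  by have := up _ (fixingV rm); rewrite -(tle m) tVK.
have [q qr hq'] := hq.
have [t Mt /andP[lt tr]] : exists2 t, M t & Num.max q z < t z < r.
  apply: orbit_dense_mem; rewrite ?le_max ?gt_max; lra.
move: lt; rewrite gt_max => /andP[qt zt].
have [rt|tr'] := lerP r (t r).
  have : fixing (t r) h by split=> // y ry; apply: hr; lra.
  move/(fixedptJ Mt fz) => E; have := hq' (t z); rewrite E eqxx.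
  by move=> /(_ _)/negP; apply; rewrite ?qt ?tr.
have : z <= t^-1%g z.
  apply: lbS; split; first by rewrite -(tlt t) tVK t0; lra.
  rewrite -[r](tK t); apply: fixedptJ; first exact: subgroupV.
  by move=> m [Mm mb]; apply: fz; split=> // y ry; apply: mb; lra.
by rewrite -(tle t) tVK; lra.
Qed.

(** Otherwise the supremum s of the orbit of a lies below r; an element that
    moves s to the right carries orbit points close to s beyond s. *)
Lemma push_last r a c : support_end r -> 0 < a < r -> c < r ->
  exists2 m, fixing r m & c < m a.
Proof.
move=> rP a0r cr; apply: contrapT => no.
pose S : set R := [set y | exists2 m, fixing r m & m a = y].
have Sc y : S y -> y <= c.
  move=> [m rm my]; rewrite leNgt; apply/negP => cy.
  by apply: no; exists m; rewrite ?my.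
have Sa : S a by exists 1%g => //; split; [exact: subgroup1|].
have hS : has_sup S by split; [exists a|exists c].
have ub y : S y -> y <= sup S by move=> ?; apply: sup_upper_bound.
have ac := ub _ Sa; have cc : sup S <= c by apply: ge_sup => //; exists a.
set s := sup S in ub ac cc *.
have [m rm ms] : exists2 m, fixing r m & s < m s.
  have [|m rm] := @fixing_no_fixed_point r s rP; first lra.
  case: ltgtP => // ms _; last by exists m.
  by exists m^-1%g; [exact: fixingV|rewrite -(tlt m) tVK].
have : m^-1%g s < s by rewrite -(tlt m) tVK.
rewrite -subr_gt0 => lt; have [y [n rn na]] := sup_adherent lt hS.
rewrite subKr -(tlt m) tVK => sy.
have : m y <= s by apply: ub; exists (n * m)%g; [exact: fixingM|rewrite tmulE na].
by lra.
Qed.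

Lemma push r t a c : support_end r -> M t -> 0 < a < t r -> c < t r ->
  exists2 m, fixing (t r) m & c < m a.
Proof.
move=> rP Mt /andP[a0 ar] cr.
have [||m rm cm] := @push_last r (t^-1%g a) (t^-1%g c) rP.
- by rewrite -(tlt t) t0 tVK a0 -(tlt t) tVK ar.
- by rewrite -(tlt t) tVK.
by exists (m ^ t)%g; [exact: fixingJ|rewrite tJE -(tlt t^-1%g) tK].
Qed.

(** Conjugate d by an element g that is the identity beyond t r and pushes a
    beyond c: on [a, t r] the image of g lies where d is the identity. *)
Lemma split_at r t d c a : support_end r -> M t -> M d -> c < t r ->
  (forall y, c <= y <= t r -> d y = y) -> 0 < a < t r ->
  exists e, [/\ M e, forall y, a <= y <= t r -> e y = y &
    forall y, t r <= y -> e y = d y].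
Proof.
move=> rP Mt Md cr dc ar; have [g [Mg gx] cg] := push rP Mt ar cr.
exists (g * d * g^-1)%g; split.
- by do !(apply: subgroupM || apply: subgroupV).
- move=> y /andP[ay yr]; rewrite !tmulE dc ?tK //.
  by rewrite -(gx (t r)) // tle yr (le_trans (ltW cg)) ?tle.
- move=> y ry; rewrite !tmulE gx // -{1}(gx (d y)) ?tK //.
  by rewrite -(dc (t r)) ?tle // lexx ltW.
Qed.

(** Extend agreement from [a, t] to a neighbourhood of its supremum s. If m1
    agrees with f on [a, t] and m2 agrees with f near s, then the quotient of
    m2 by m1 is the identity on an overlap; cutting it at a point of the dense
    orbit of r and multiplying by m1 glues m1 and m2. *)
Lemma agree_interval r f a b : support_end r -> 0 < a -> a <= b -> b < 1 ->
  exists2 m, M m & forall y, a <= y <= b -> f y = m y.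
Proof.
move=> rP a0 ab b1.
have r01 : 0 < r < 1 by case: rP => h [].
pose T : set R := [set t | a <= t <= b /\
  exists2 m, M m & forall y, a <= y <= t -> f y = m y].
have Ta : T a.
  split; first by rewrite lexx.
  have [m Mm /agree_at_val fm] := germ_mem true f a.
  exists m => // y ya; suff -> : y = a by [].
  by apply/eqP; rewrite eq_le; lra.
have hT : has_sup T by split; [exists a|exists b => y [/andP[]]].
have sb : sup T <= b by apply: ge_sup; [exists a|move=> y [/andP[]]].
have sa : a <= sup T by apply: sup_upper_bound.
set s := sup T in sb sa *.
have [|m2 [e [M2 e0 f2]]] := @local_mem f s; first lra.
have [m Mm fm] : exists2 m, M m & forall y, a <= y <= s + e -> f y = m y.
  have [se|se] := ltrP (s - e) a.
    by exists m2 => // y ya; apply: f2; lra.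
  have [t [/andP[at_ tb] [m1 M1 f1]] st] := sup_adherent e0 hT.
  rewrite -/s in st.
  have ts : t <= s by apply: sup_upper_bound => //; split; [rewrite at_|exists m1].
  have [u Mu /andP[su ut]] : exists2 u, M u & s - e < u r < t.
    by apply: orbit_dense_mem => //; lra.
  have [|||y yu||k [Mk k1 k2]] := @split_at r u (m2 * m1^-1)%g (s - e) a rP.
  - by [].
  - by apply: subgroupM => //; apply: subgroupV.
  - exact: su.
  - rewrite tmulE -f2; last lra.
    by rewrite f1 ?tK //; lra.
  - lra.
  exists (k * m1)%g => [|y /andP[ay ye]]; first exact: subgroupM.
  rewrite tmulE; have [yu|uy] := lerP y (u r).
    by rewrite k1 ?ay // f1 //; lra.
  by rewrite k2 ?ltW // tmulE tVK f2 //; lra.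
have [be|eb] := lerP b (s + e).
  by exists m => // y yb; apply: fm; lra.
suff : s + e <= s by lra.
by apply: sup_upper_bound => //; split; [lra|exists m].
Qed.

(** * Commutators of elements with small support *)

Lemma support_end_ex : exists r, support_end r.
Proof.
have [h [Mh h0 h1]] := ends_slopes_mem 1 0.
have hn : log_slope false h 0 != 0 by rewrite h0.
have [r [r01 hr hq]] := last_support hn h1.
by exists r, h.
Qed.

(** Divide m by elements of M that have the same germ as m at one end and are
    trivial at the other; conjugation shrinks their supports towards the
    ends. *)
Lemma trim_ends m (a b : R) : M m -> 0 < a -> a <= b -> b < 1 ->
  exists t, [/\ M t, ends_trivial t & forall y, a <= y <= b -> t y = m y].
Proof.
move=> Mm a0 ab b1.
have [p [Mp p0 p1]] := ends_slopes_mem (log_slope false m 0) 0.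
have [q [Mq q0 q1]] := ends_slopes_mem 0 (log_slope true m 1).
have [c c01 pc] := identity_near1 p1; have [d d01 qd] := identity_near0 q0.
have ma01 : 0 < m a < 1 by rewrite t01; lra.
have mb01 : 0 < m b < 1 by rewrite t01; lra.
have [||u Mu /andP[_ uc]] := @orbit_dense_mem c 0 (m a) c01 (lexx _); [lra..|].
have [|||v Mv /andP[vd _]] := @orbit_dense_mem d (m b) 1 d01; [lra..|].
exists (m * (p ^ u)^-1 * (q ^ v)^-1)%g; split.
- by rewrite !conjgE; do !(apply: subgroupM || apply: subgroupV).
- split; rewrite !conjgE !log_slopeM !log_slopeV !log_slopeM !log_slopeV.
    by rewrite !t0 p0 q0; lia.
  by rewrite !t1 p1 q1; lia.
- move=> y /andP[ay yb]; rewrite !tmulE.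
  have pf : (p ^ u)%g (m y) = m y.
    rewrite tJE pc ?tVK // -(tle u) tVK; apply: le_trans (ltW uc) _.
    by rewrite tle.
  have qf : (q ^ v)%g (m y) = m y.
    rewrite tJE qd ?tVK // -(tle v) tVK; apply: le_trans (ltW vd).
    by rewrite tle.
  by rewrite (fixV pf) (fixV qf).
Qed.

(** Apply [commutator_agree] to m in M that agrees with f on an interval
    containing both supports, trimmed so that its own support is compact, and
    to n in M that agrees with g on an interval containing the support of m. *)
Lemma commutator_mem f g : ends_trivial f -> ends_trivial g -> M [~ f, g]%g.
Proof.
move=> /ends_trivialP[a [b [a0 ab b1 fo]]] /ends_trivialP[c [d [c0 cd d1 go]]].
have [r rP] := support_end_ex.
pose p := Num.min a c; pose q := Num.max b d.
have [pa pc p0] : [/\ p <= a, p <= c & 0 < p].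
  by rewrite !ge_min !lexx orbT lt_min a0 c0.
have [bq dq q1] : [/\ b <= q, d <= q & q < 1].
  by rewrite !le_max !lexx orbT gt_max b1 d1.
have pq : p <= q by lra.
clearbody p q.
have [m1 Mm1 fm1] := agree_interval f rP p0 pq q1.
have [m [Mm mB mm1]] := trim_ends Mm1 p0 pq q1.
have [a' [b' [a'0 ab' b'1 mo]]] := ends_trivialP mB.
pose p' := Num.min a' p; pose q' := Num.max b' q.
have [pa' pp p'0] : [/\ p' <= a', p' <= p & 0 < p'].
  by rewrite !ge_min !lexx orbT lt_min a'0 p0.
have [bq' qq q'1] : [/\ b' <= q', q <= q' & q' < 1].
  by rewrite !le_max !lexx orbT gt_max b'1 q1.
clearbody p' q'.
have pq' : p' <= q' by lra.
have [n Mn gn] := agree_interval g rP p'0 pq' q'1.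
rewrite (@commutator_agree _ f g m n p q p' q') //.
- by rewrite commgEl conjgE; do !(apply: subgroupM || apply: subgroupV).
- exact: identity_off_sub fo.
- exact: identity_off_sub go.
- exact: identity_off_sub mo.
- by move=> y ypq; rewrite fm1 ?mm1.
Qed.

(** M is normalised by itself and by [ends_trivial]: for b in [ends_trivial],
    the commutator of k in M and b does not change when k is replaced by a
    trimmed t in M, and then it is in M by [commutator_mem]. *)
Lemma maximal_piecewise_total_absurd : False.
Proof.
apply: nnM => m g Mm; have [n [b [Mn bB ->]]] := maximal_mul_ends g.
rewrite conjgM; set k := (m ^ n)%g.
have Mk : M k by rewrite /k conjgE; do !(apply: subgroupM || apply: subgroupV).
have -> : (k ^ b = k * [~ k, b])%g by rewrite commgEl mulVKg.
apply: subgroupM => //.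
have [c [d [c0 cd d1 bo]]] := ends_trivialP bB.
have [t [Mt tB tk]] := trim_ends Mk c0 cd d1.
by rewrite (commutator_agree_conj cd bo tk); apply: commutator_mem.
Qed.

End MaximalSubgroup.

(** * The theorem *)

Theorem theorem1p1 (R : realType) (M : set (thompsonF R)) :
  maximal_subgroup M -> infinite_index M -> closed_subgroup M.
Proof.
move=> maxM infM; have [sM _ maximalM] := maxM.
case: (maximalM _ (subgroup_piecewise sM) (sub_piecewise (M := M))) => [pwE|pwT].
  apply: (glued_closed sM) => c f g c01 dc fg Mf Mg.
  by rewrite -pwE; apply: piecewise_glue.
have nnM : ~ normal_set M by move=> /(normal_maximal_finite_index maxM).
by case: (maximal_piecewise_total_absurd maxM nnM pwT).
Qed.
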